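(* Let $n \in \mathbb{N}$, $m \in \{0,\ldots,n-1\}$, $s > m$, and $0 < \alpha \le 1$. Then there exists a constant $c = c(n,m,s,\alpha) > 0$, depending only on $n,m,s,\alpha$, such that for every measure $\mu$ on $\mathbb{R}^n$ with $\dim_{\mathrm H}(\mu) \ge s$ we have $$\limsup_{r \downarrow 0} \inf_{\theta \in S^{n-1},\; V \in G(n,n-m)} \frac{\mu\bigl( X(x,r,V,\alpha) \setminus H(x,\theta,\alpha) \bigr)}{\mu\bigl( B(x,r) \bigr)} > c$$ for $\mu$-almost every $x \in \mathbb{R}^n$.
   Context: A measure on $\mathbb{R}^n$ always means a finite, nontrivial (not identically zero) Borel regular outer measure defined on all subsets of $\mathbb{R}^n$. The (lower) Hausdorff dimension of $\mu$ is $\dim_{\mathrm H}(\mu) = \inf\{ \dim_{\mathrm H}(A) : A \text{ is a Borel set with } \mu(A) > 0 \}$, where $\dim_{\mathrm H}(A)$ is the Hausdorff dimension of the set $A$. $B(x,r)$ is the closed ball with centre $x$ and radius $r>0$, $S^{n-1}$ is the unit sphere of $\mathbb{R}^n$, and $G(n,n-m)$ is the space of all $(n-m)$-dimensional linear subspaces of $\mathbb{R}^n$. For $x \in \mathbb{R}^n$, $\theta \in S^{n-1}$, $0 \le \alpha \le 1$, $V \in G(n,n-m)$ and $r>0$, $$H(x,\theta,\alpha) = \{ y \in \mathbb{R}^n : (y-x)\cdot\theta > \alpha |y-x| \},$$ $$X(x,V,\alpha) = \{ y \in \mathbb{R}^n : \mathrm{dist}(y-x,V) < \alpha |y-x| \},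 \qquad X(x,r,V,\alpha) = B(x,r) \cap X(x,V,\alpha).$$ *)

(* Defs.v *)
From HB Require Import structures.
From mathcomp Require Import all_boot all_order all_algebra.
From mathcomp Require Import all_classical all_reals all_analysis.

Set Implicit Arguments.
Unset Strict Implicit.
Unset Printing Implicit Defensive.

Import Order.TTheory GRing.Theory Num.Theory.
Import numFieldNormedType.Exports.

Local Open Scope classical_set_scope.
Local Open Scope ring_scope.

(* R^n is 'rV[R]_n. The library norm `|x| on row vectors is the sup norm, so
   the Euclidean notions are introduced here; the library topology is the
   Euclidean one, since both norms are equivalent. *)

Definition dotv (R : realType) (n : nat) (u v : 'rV[R]_n) : R :=
  \sum_(i < n) u 0 i * v 0 i.

Definition enorm (R : realType) (n : nat) (u : 'rV[R]_n) : R :=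
  Num.sqrt (dotv u u).

Definition eball (R : realType) (n : nat) (x : 'rV[R]_n) (r : R) :
    set 'rV[R]_n :=
  [set y | enorm (y - x) <= r].

Definition esphere (R : realType) (n : nat) : set 'rV[R]_n :=
  [set theta | enorm theta = 1].

Definition grassmannian (R : realType) (n k : nat) : set {vspace 'rV[R]_n} :=
  [set V | \dim V = k].

Definition dist_subspace (R : realType) (n : nat) (z : 'rV[R]_n)
    (V : {vspace 'rV[R]_n}) : R :=
  inf [set enorm (z - v) | v in [set v | v \in V]].

Definition half_cone (R : realType) (n : nat) (x theta : 'rV[R]_n)
    (alpha : R) : set 'rV[R]_n :=
  [set y | dotv (y - x) theta > alpha * enorm (y - x)].

Definition cone (R : realType) (n : nat) (x : 'rV[R]_n)
    (V : {vspace 'rV[R]_n}) (alpha : R) : set 'rV[R]_n :=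
  [set y | dist_subspace (y - x) V < alpha * enorm (y - x)].

Definition bounded_cone (R : realType) (n : nat) (x : 'rV[R]_n) (r : R)
    (V : {vspace 'rV[R]_n}) (alpha : R) : set 'rV[R]_n :=
  eball x r `&` cone x V alpha.

Local Open Scope ereal_scope.

Definition diam (R : realType) (n : nat) (A : set 'rV[R]_n) : \bar R :=
  ereal_sup [set (enorm (x - y))%:E | x in A & y in A].

(* diam(A)^t, with the usual conventions that the empty set contributes 0 for
   every t (including t = 0) and a nonempty set contributes 1 for t = 0. *)
Definition diam_pow (R : realType) (n : nat) (t : R) (A : set 'rV[R]_n) :
    \bar R :=
  if A == set0 then 0 else diam A `^ t.

(* Since diam set0 = -oo, empty sets are allowed in the sequence F, so finite
   covers are included. *)
Definition hausdorff_premeasure (R : realType) (n : nat) (t delta : R)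
    (A : set 'rV[R]_n) : \bar R :=
  ereal_inf [set \sum_(0 <= i <oo) diam_pow t (F i)
            | F in [set F : nat -> set 'rV[R]_n |
                     A `<=` \bigcup_i F i /\
                     forall i, diam (F i) <= delta%:E]].

(* The normalizing constant of the Hausdorff measure is omitted; it does not
   affect the dimension. *)
Definition hausdorff_measure (R : realType) (n : nat) (t : R)
    (A : set 'rV[R]_n) : \bar R :=
  ereal_sup [set hausdorff_premeasure t delta A
            | delta in [set delta : R | (0 < delta)%R]].

Definition hausdorff_dim (R : realType) (n : nat) (A : set 'rV[R]_n) :
    \bar R :=
  ereal_inf [set t%:E
            | t in [set t : R | (0 <= t)%R /\ hausdorff_measure t A = 0]].

Definition borel_sets (R : realType) (n : nat) : set (set 'rV[R]_n) :=
  <<s [set U : set 'rV[R]_n | open U] >>.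

Definition borel_regular (R : realType) (n : nat)
    (mu : {outer_measure set 'rV[R]_n -> \bar R}) : Prop :=
  (forall B, borel_sets B -> mu.-caratheodory B) /\
  (forall A, exists B, [/\ borel_sets B, A `<=` B & mu B = mu A]).

Definition is_measure (R : realType) (n : nat)
    (mu : {outer_measure set 'rV[R]_n -> \bar R}) : Prop :=
  [/\ borel_regular mu, mu setT < +oo & mu setT != 0].

Definition hausdorff_dim_measure (R : realType) (n : nat)
    (mu : {outer_measure set 'rV[R]_n -> \bar R}) : \bar R :=
  ereal_inf [set hausdorff_dim A
            | A in [set A : set 'rV[R]_n | borel_sets A /\ 0 < mu A]].

Definition outer_ae (R : realType) (n : nat)
    (mu : {outer_measure set 'rV[R]_n -> \bar R})
    (P : 'rV[R]_n -> Prop) : Prop :=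
  mu [set x | ~ P x] = 0.

Definition cone_ratio_inf (R : realType) (n m : nat) (alpha : R)
    (mu : {outer_measure set 'rV[R]_n -> \bar R}) (x : 'rV[R]_n) (r : R) :
    \bar R :=
  ereal_inf [set mu (bounded_cone x r V alpha `\` half_cone x theta alpha)
                   / mu (eball x r)
            | theta in @esphere R n & V in @grassmannian R n (n - m)%N].

(* Main.v *)
Require Import Defs.
From HB Require Import structures.
From mathcomp Require Import all_boot all_order all_algebra.
From mathcomp Require Import all_classical all_reals all_analysis.
From mathcomp Require Import ring lra zify.
Import Order.TTheory GRing.Theory Num.Theory.
Import numFieldNormedType.Exports.
Local Open Scope classical_set_scope.
Local Open Scope ring_scope.

(** The proof is by contradiction.  Suppose that at every point x of a set A of
    positive measure the ratio stays below some eps for all small r: some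
    theta and V depending on x and r satisfy
    mu (X(x,r,V,alpha) \ H(x,theta,alpha)) <= eps * mu (B(x,r)).
    A Borel set of positive measure and of dimension less than s is then
    constructed, which contradicts dim mu >= s.  The number eps must be chosen
    before mu and A.

    Geometry ([cone_pigeonhole], [few_heavy]).  Divide a cube Q of side l into
    N^n subcubes of side l/N.  A subcube Q' is heavy if
    mu (A `&` Q') > eps * mu (halo Q), where the halo is the cube concentric
    with Q and 2n+1 times as large.  At most C * N^m subcubes are heavy, where C
    does not depend on N.  Indeed each heavy Q' contains a point of A, with its
    theta and V for r = n*l.  Among more than C * N^m such points, many
    well-separated ones have nearly the same V and, since the orthogonal
    complement of V is m-dimensional, nearly the same projection onto it at
    scale l/N; all their differences are then close to V.  By a Ramsey-type
    argument three of these points y1, x, y2 lie almost on a line, x in the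
    middle.  The directions of y1 - x and y2 - x are almost opposite, so the
    half-cone H(x,theta,alpha) misses the subcube of y1 or the one of y2.  That
    subcube lies in X(x,n*l,V,alpha) \ H(x,theta,alpha), hence has measure at
    most eps * mu (B(x,n*l)) <= eps * mu (halo Q), and is not heavy.

    Counting ([count_few_bad], [mass_few_bad]).  In the N-adic tree below a
    cube Q0, call a step from a cube to a subcube bad if the subcube is not
    heavy.  The subcubes reached by bad steps at a given level carry at most
    N^n * eps * sum_Q mu (halo Q) <= N^n * eps * (2n+1)^n * mu (halo Q0),
    because the halos of the cubes of one level overlap boundedly.  If
    mu (halo Q0) is bounded by a constant times mu (A `&` Q0), then for a
    suitable eps Markov's inequality gives half of mu (A `&` Q0) to the leaves
    of depth b*L with at most L bad steps.  There are at most
    ((2 C N^m)^b * N^n)^L of them and their side is of order N^(-b*L), so that,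
    for suitable b and N, the sum of the t-th powers of their diameters tends
    to 0 geometrically for t = (m+s)/2.  The upper limit, as L grows, of the
    unions of these leaves has positive measure and vanishing t-dimensional
    Hausdorff measure ([hausdorff_limsup_null]).

    A root cube Q0 with mu (halo Q0) <= constant * mu (A `&` Q0) exists at
    arbitrarily small scales ([dense_box]).  This replaces a density theorem: it
    follows from outer regularity and from the bounded overlap of halos. *)

Set Implicit Arguments.
Unset Strict Implicit.
Unset Printing Implicit Defensive.

(** * Paths with few bad steps in a finite tree *)

Section Words.
Variable T : finType.
Implicit Types (w : seq T) (good : seq T -> T -> bool).

(** The nodes of level J of the |T|-ary tree are the words of length J; the last
    step is the head of the word, so that the parent of a :: w is w. *)
Fixpoint words (J : nat) : seq (seq T) :=
  if J is J'.+1 then [seq a :: w | w <- words J', a <- enum T] else [:: [::]].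

Fixpoint nbad good w : nat :=
  if w is a :: w' then ~~ good w' a + nbad good w' else 0%N.

Lemma big_words (V : nmodType) (F : seq T -> V) (P : pred (seq T)) J :
  \sum_(w <- words J.+1 | P w) F w =
  \sum_(w <- words J) \sum_(a | P (a :: w)) F (a :: w).
Proof.
rewrite big_mkcond [words _]/= big_allpairs_dep; apply: eq_bigr => w _.
by rewrite [RHS]big_mkcond big_enum.
Qed.

Lemma words_uniq J : uniq (words J).
Proof.
elim: J => // J IH /=; apply: allpairs_uniq => //; first exact: enum_uniq.
by move=> [w a] [w' a'] _ _ /= [-> ->].
Qed.

Lemma size_words J w : w \in words J -> size w = J.
Proof.
elim: J w => [|J IH] w /=; first by rewrite inE => /eqP ->.
by move=> /allpairsP[[w' a] [/= /IH <- _ ->]].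
Qed.

(** A word with at most d bad steps is built letter by letter: a good step
    leaves at most M choices, a bad one |T|, and the positions of the bad steps
    are paid for by the factor 2^J. *)
Lemma count_few_bad good M J d : (0 < M)%N -> (0 < #|T|)%N ->
  (forall w, #|[pred a | good w a]| <= M)%N ->
  (count (fun w => nbad good w <= d)%N (words J) <= (2 * M) ^ J * #|T| ^ d)%N.
Proof.
move=> M0 T0 HM.
elim: J d => [|J IH] d.
  by rewrite /= addn0 expn0 mul1n expn_gt0 T0.
pose c e := count (fun w => nbad good w <= e)%N (words J).
have step : (count (fun w => nbad good w <= d)%N (words J.+1) <=
   M * c d + (if d is e.+1 then #|T| * c e else 0))%N.
  have -> : (if d is e.+1 then #|T| * c e else 0)%N =
      (\sum_(w <- words J) if (nbad good w < d)%N then #|T| else 0)%N.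
    case: d => [|e]; first by rewrite big1.
    rewrite /c -sum1_count big_distrr /= big_mkcond; apply: eq_bigr => w _.
    by rewrite ltnS muln1.
  rewrite -sum1_count big_words /c -sum1_count.
  rewrite (big_mkcond (fun w => (nbad good w <= d)%N)) big_distrr /=.
  rewrite -big_split /=; apply: leq_sum => w _.
  rewrite (bigID (good w)) /=; apply: leq_add.
    case: (leqP (nbad good w) d) => hw.
      rewrite muln1; apply: leq_trans (HM w); rewrite -sum1_card.
      rewrite [leqRHS](eq_bigl (good w)) //; apply: sub_le_big => //=.
        by move=> x y; exact: leq_addr.
      by move=> a /andP[].
    rewrite big_pred0 // => a; apply/negbTE; rewrite negb_and -ltnNge;
      apply/orP.
    by left; rewrite (leq_trans hw)// leq_addl.
  case: (ltnP (nbad good w) d) => hw.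
    rewrite -sum1_card; apply: sub_le_big => //= x y; exact: leq_addr.
  rewrite big_pred0 // => a; apply/negbTE; rewrite andbC.
  by case: (good w a) => //=; rewrite add1n -ltnNge.
apply: (leq_trans step).
have -> : ((2 * M) ^ J.+1 * #|T| ^ d =
    M * ((2 * M) ^ J * #|T| ^ d) + M * ((2 * M) ^ J * #|T| ^ d))%N.
  by rewrite expnS; ring.
apply: leq_add; first by rewrite leq_mul2l IH orbT.
case: d {step} => [|e] //.
have -> : (M * ((2 * M) ^ J * #|T| ^ e.+1) =
    #|T| * (M * ((2 * M) ^ J * #|T| ^ e)))%N by rewrite expnS; ring.
by rewrite leq_mul2l (leq_trans (IH e)) ?orbT// leq_pmull.
Qed.

Section Mass.
Variables (R : realFieldType) (f : seq T -> R) (good : seq T -> T -> bool).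
Hypothesis f0 : forall w, 0 <= f w.
Hypothesis fsub : forall w, \sum_a f (a :: w) <= f w.

(** Every bad step is charged with the mass of the leaves below it, which is at
    most the mass of the node that it reaches. *)
Lemma sum_mass_nbad J :
  \sum_(w <- words J) f w * (nbad good w)%:R <=
  \sum_(j < J) \sum_(w <- words j) \sum_(a | ~~ good w a) f (a :: w).
Proof.
elim: J => [|J IH]; first by rewrite big_seq1 big_ord0 mulr0.
rewrite big_words big_ord_recr /=.
apply: le_trans (lerD IH (lexx _)); rewrite -big_split /=.
apply: ler_sum => w _.
have -> : \sum_(a : T) f (a :: w) * (~~ good w a + nbad good w)%:R =
   (\sum_a f (a :: w)) * (nbad good w)%:R + \sum_(a | ~~ good w a) f (a :: w).
  rewrite mulr_suml [X in _ + X]big_mkcond -big_split; apply: eq_bigr => a _ /=.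
  by case: (good w a) => /=; rewrite ?add0n ?addr0// natrD mulrDr mulr1 addrC.
by rewrite lerD2r ler_wpM2r.
Qed.

(** Markov's inequality for the number of bad steps. *)
Lemma mass_few_bad (eta : R) J d :
  (forall j, (j < J)%N ->
    \sum_(w <- words j) \sum_(a | ~~ good w a) f (a :: w) <= eta) ->
  \sum_(w <- words J) f w - J%:R * eta / d.+1%:R <=
  \sum_(w <- words J | (nbad good w <= d)%N) f w.
Proof.
move=> Heta; rewrite lerBlDr (bigID (fun w => (nbad good w <= d)%N)) /=.
rewrite lerD2l ler_pdivlMr ?ltr0n//.
apply: (@le_trans _ _ (\sum_(w <- words J) f w * (nbad good w)%:R)).
  rewrite mulr_suml big_mkcond /=; apply: ler_sum => w _; case: ifPn.
    by rewrite -ltnNge => h; rewrite ler_wpM2l// ler_nat.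
  by rewrite mulr_ge0.
apply: le_trans (sum_mass_nbad J) _.
rewrite mulrC mulr_natr -[X in _ *+ X]card_ord -sumr_const.
by apply: ler_sum => j _; exact: Heta.
Qed.

End Mass.
End Words.

(** * Euclidean geometry of cones *)

Section Euclid.
Variables (R : realType) (n : nat).
Implicit Types (u v w : 'rV[R]_n) (V : {vspace 'rV[R]_n}).

Lemma dotvC u v : dotv u v = dotv v u.
Proof. by apply: eq_bigr => i _; rewrite mulrC. Qed.

Lemma dotvDl u v w : dotv (u + v) w = dotv u w + dotv v w.
Proof. by rewrite -big_split; apply: eq_bigr => i _; rewrite mxE mulrDl. Qed.

Lemma dotvZl a u v : dotv (a *: u) v = a * dotv u v.
Proof. by rewrite /dotv mulr_sumr; apply: eq_bigr => i _;
  rewrite mxE mulrA. Qed.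

Lemma dotvNl u v : dotv (- u) v = - dotv u v.
Proof. by rewrite -scaleN1r dotvZl mulN1r. Qed.

Lemma dotvBl u v w : dotv (u - v) w = dotv u w - dotv v w.
Proof. by rewrite dotvDl dotvNl. Qed.

Lemma dotvBr u v w : dotv u (v - w) = dotv u v - dotv u w.
Proof. by rewrite !(dotvC u) dotvBl. Qed.

Lemma dotv_suml I (r : seq I) (F : I -> 'rV[R]_n) v :
  dotv (\sum_(i <- r) F i) v = \sum_(i <- r) dotv (F i) v.
Proof.
elim/big_rec2: _ => [|i x y _ <-]; last by rewrite dotvDl.
by rewrite -(scale0r 0) dotvZl mul0r.
Qed.

Lemma dotv_ge0 u : 0 <= dotv u u.
Proof. by apply: sumr_ge0 => i _; rewrite -expr2 sqr_ge0. Qed.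

Lemma sqr_enorm u : enorm u ^+ 2 = dotv u u.
Proof. by rewrite sqr_sqrtr// dotv_ge0. Qed.

Lemma enorm_ge0 u : 0 <= enorm u.
Proof. exact: sqrtr_ge0. Qed.

Lemma coord_le_enorm u i : `|u 0 i| <= enorm u.
Proof.
rewrite -sqrtr_sqr ler_wsqrtr// /dotv (bigD1 i)//= expr2 lerDl.
by apply: sumr_ge0 => j _; rewrite -expr2 sqr_ge0.
Qed.

Lemma enorm_eq0 u : enorm u = 0 -> u = 0.
Proof.
move=> u0; apply/rowP => i; rewrite mxE; apply/eqP; rewrite -normr_eq0 eq_le.
by rewrite normr_ge0 andbT -u0 coord_le_enorm.
Qed.

Lemma enormZ a u : enorm (a *: u) = `|a| * enorm u.
Proof.
by rewrite /enorm dotvZl dotvC dotvZl mulrA -expr2 sqrtrM ?sqr_ge0// sqrtr_sqr.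
Qed.

Lemma enormN u : enorm (- u) = enorm u.
Proof. by rewrite -scaleN1r enormZ normrN1 mul1r. Qed.

Lemma dotv_le_enorm u v : dotv u v <= enorm u * enorm v.
Proof.
have [u0|un0] := eqVneq (enorm u) 0.
  by rewrite u0 (enorm_eq0 u0) -(scale0r 0) dotvZl !mul0r.
have [v0|vn0] := eqVneq (enorm v) 0.
  by rewrite v0 (enorm_eq0 v0) dotvC -(scale0r 0) dotvZl mul0r mulr0.
have up : 0 < enorm u by rewrite lt_def un0 enorm_ge0.
have vp : 0 < enorm v by rewrite lt_def vn0 enorm_ge0.
have := dotv_ge0 (enorm v *: u - enorm u *: v).
rewrite dotvBl !dotvBr !dotvZl !(dotvC _ (_ *: _)) !dotvZl (dotvC v u)
  -!sqr_enorm.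
set a := enorm u in up *; set b := enorm v in vp *; set c := dotv u v => h.
have : 0 <= 2 * (a * b) * (a * b - c) by lra.
by rewrite pmulr_rge0 ?subr_ge0// !mulr_gt0.
Qed.

Lemma enormD u v : enorm (u + v) <= enorm u + enorm v.
Proof.
rewrite -(@ler_pXn2r _ 2%N) ?nnegrE ?addr_ge0 ?enorm_ge0// sqr_enorm.
rewrite dotvDl !(dotvC _ (u + v)) !dotvDl (dotvC v u) -!sqr_enorm.
have := dotv_le_enorm u v; lra.
Qed.

Lemma ler_dotv_coord u v (a b : R) : 0 <= b ->
  (forall i, `|u 0 i| <= a) -> (forall i, `|v 0 i| <= b) ->
  `|dotv u v| <= n%:R * (a * b).
Proof.
move=> b0 ua vb; rewrite /dotv (le_trans (ler_norm_sum _ _ _))//.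
rewrite mulr_natl -[X in _ *+ X]card_ord -sumr_const; apply: ler_sum => i _.
by rewrite normrM ler_pM.
Qed.

Lemma enorm_le_coord u (a : R) : (forall i, `|u 0 i| <= a) ->
  enorm u <= n%:R * a.
Proof.
move=> ua; have [n0|n0] := posnP n.
  rewrite /enorm /dotv big1 ?sqrtr0 ?n0 ?mul0r// => i _.
  by have := ltn_ord i; rewrite [X in (_ < X)%N]n0.
have a0 : 0 <= a := le_trans (normr_ge0 _) (ua (Ordinal n0)).
rewrite -(@ler_pXn2r _ 2%N) ?nnegrE ?enorm_ge0 ?mulr_ge0 //. rewrite sqr_enorm.
apply: (@le_trans _ _ (n%:R * (a * a))).
  rewrite /dotv mulr_natl -[X in _ *+ X]card_ord -sumr_const.
  by apply: ler_sum => i _; rewrite -[_ * _]ger0_norm ?normrM ?ler_pM// -expr2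
    sqr_ge0.
rewrite exprMn -expr2 ler_wpM2r ?sqr_ge0//.
by rewrite -natrX ler_nat -mulnn leq_pmulr.
Qed.

Lemma dist_subspace_le u v V : v \in V -> dist_subspace u V <= enorm (u - v).
Proof.
move=> vV; apply: ge_inf; last by exists v.
by exists 0 => _ [w _ <-]; exact: enorm_ge0.
Qed.

Lemma exists_orthogonal V : (\dim V < n)%N ->
  exists w, enorm w = 1 /\ forall v, v \in V -> dotv v w = 0.
Proof.
move=> Vn.
pose B : 'M[R]_(\dim V, n) := \matrix_(i, j) (vbasis V)`_i 0 j.
have : kermx B^T != 0.
  rewrite -mxrank_eq0 mxrank_ker mxrank_tr subn_eq0 -ltnNge.
  exact: leq_ltn_trans (rank_leq_row B) Vn.
case/rowV0Pn => w /sub_kermxP wB wn0.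
have wV v : v \in V -> dotv v w = 0.
  move=> vV; rewrite (coord_vbasis vV) dotv_suml big1// => i _.
  rewrite dotvZl; have := congr1 (fun A : 'rV[R]_(\dim V) => A 0 i) wB.
  rewrite [LHS]mxE [RHS]mxE => h; rewrite dotvC.
  have -> : dotv w (vbasis V)`_i = 0.
    by rewrite -[RHS]h; apply: eq_bigr => j _; rewrite !mxE.
  by rewrite mulr0.
have wp : 0 < enorm w.
  by rewrite lt_def enorm_ge0 andbT; apply: contra_neq wn0; exact: enorm_eq0.
exists ((enorm w)^-1 *: w); split.
  by rewrite enormZ ger0_norm ?invr_ge0 ?ltW// mulVf ?gt_eqF.
by move=> v /wV h; rewrite dotvC dotvZl dotvC h mulr0.
Qed.

(** Adjoin to V a unit vector orthogonal to V, and use induction on the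
    codimension.  Frames are indexed by natural numbers, so that a vector can be
    appended without changing the type of indices. *)
Lemma orthonormal_complement k V : (\dim V + k = n)%N ->
  exists W : nat -> 'rV[R]_n,
  [/\ forall j, (j < k)%N -> enorm (W j) = 1,
      forall j v, (j < k)%N -> v \in V -> dotv v (W j) = 0 &
      forall u, u - \sum_(j < k) dotv u (W j) *: W j \in V].
Proof.
elim: k V => [|k IH] V dV.
  exists (fun _ => 0); split=> // u; rewrite big_ord0 subr0.
  suff -> : V = fullv by rewrite memvf.
  apply/eqP; rewrite eqEdim subvf dimvf /= -[X in (_ <= X)%N]addn0 dV.
  by rewrite /dim /= mul1n.
have Vn : (\dim V < n)%N by move: dV; lia.
have [w [w1 wV]] := exists_orthogonal Vn.
have wNV : w \notin V.
  apply/negP => /wV; rewrite -sqr_enorm w1 expr1n; exact/eqP/oner_neq0.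
pose V' := (V + <[w]>)%VS.
have dV' : (\dim V' + k = n)%N.
  rewrite dimv_disjoint_sum ?dim_vline.
    have -> : (w != 0) by apply: contraNneq wNV => ->; rewrite mem0v.
    by rewrite addn1 addSnnS.
  apply/eqP; rewrite -subv0; apply/subvP => v;
    rewrite memv_cap memv0 => /andP[vV].
  case/vlineP => a va; have := wV v vV.
  rewrite va dotvZl -sqr_enorm w1 expr1n mulr1 => ->.
  by rewrite scale0r.
have wV' : w \in V' by rewrite memvE addvSr.
have [W' [W1 W2 W3]] := IH _ dV'.
pose W j := if (j < k)%N then W' j else w.
exists W; split.
- by move=> j _; rewrite /W; case: ifP => // /W1.
- move=> j v _ vV; rewrite /W; case: ifP => [jk|_]; last exact: wV.
  by apply: W2 => //; exact: (subvP (addvSl _ _)) vV.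
- have Wk : W k = w by rewrite /W ltnn.
  move=> u; rewrite big_ord_recr /= Wk.
  under eq_bigr do rewrite /W ltn_ord.
  have /memv_addP[v vV [y /vlineP[a ->] e]] := W3 u.
  have := congr1 (fun z => dotv z w) e; rewrite dotvBl dotv_suml big1 => [|i _];
    last first.
    by rewrite dotvZl (dotvC _ w) (W2 _ _ (ltn_ord i) wV') mulr0.
  rewrite subr0 dotvDl (wV v)// add0r dotvZl -sqr_enorm w1 expr1n mulr1 => ->.
  rewrite opprD addrA e.
  by rewrite addrK.
Qed.


Lemma dist_subspace_le_coords k V (W : nat -> 'rV[R]_n) u :
  (forall j, (j < k)%N -> enorm (W j) = 1) ->
  u - \sum_(j < k) dotv u (W j) *: W j \in V ->
  dist_subspace u V <= \sum_(j < k) `|dotv u (W j)|.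
Proof.
move=> W1 /dist_subspace_le /le_trans; apply.
rewrite opprB addrC subrK.
elim: k W1 => [|k IH] W1.
  by rewrite !big_ord0 -(scale0r 0) enormZ normr0 mul0r.
rewrite !big_ord_recr /=; apply: le_trans (enormD _ _) _; apply: lerD.
  by apply: IH => j jk; apply: W1; rewrite ltnS ltnW.
by rewrite enormZ W1// mulr1.
Qed.

(** In this section u + e is a vector from a point x to a point of the cube of
    side d that contains y = x + u.  The distance of x and y is at least K * d,
    and K is so large compared with n / alpha that errors of size d, or of
    relative size 1 / K, are harmless. *)
Section Cones.
Variables (K : nat) (alpha d : R).
Hypotheses (alpha0 : 0 < alpha) (alpha1 : alpha <= 1).
Hypothesis alphaK : 2 * n%:R * (n%:R + 1) < alpha * K%:R.
Hypothesis d0 : 0 < d.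
Variables (u e : 'rV[R]_n).
Hypothesis far : K%:R * d <= enorm u.
Hypothesis small : forall i, `|e 0 i| <= d.

Let n0 : 0 <= n%:R :> R. Proof. exact: ler0n. Qed.

Let K0 : 0 < K%:R :> R.
Proof. by rewrite -(pmulr_rgt0 _ alpha0); apply: le_lt_trans alphaK;
  rewrite !mulr_ge0// addr_ge0. Qed.

Let q := enorm u / K%:R.

Let enormE : enorm u = K%:R * q.
Proof. by rewrite /q mulrC mulfVK ?gt_eqF. Qed.

Let dq : d <= q. Proof. by rewrite /q ler_pdivlMr// mulrC. Qed.

Let enorm_e : enorm e <= n%:R * d. Proof. exact: enorm_le_coord. Qed.

Let cone_radius : (2 * n%:R * (n%:R + 1) - n%:R) * q < alpha * enorm (u + e).
Proof.
have h : enorm u - n%:R * d <= enorm (u + e).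
  have := enormD (u + e) (- e); rewrite addrK enormN => h.
  by move: enorm_e h; lra.
apply: (@lt_le_trans _ _ (alpha * (enorm u - n%:R * d)));
  last by rewrite ler_pM2l.
rewrite enormE; have q0 : 0 < q by exact: lt_le_trans dq.
have h1 : 2 * n%:R * (n%:R + 1) * q < alpha * K%:R * q by rewrite ltr_pM2r.
have h2 : alpha * (n%:R * d) <= n%:R * q.
  apply: (@le_trans _ _ (1 * (n%:R * d)));
    first by rewrite ler_wpM2r// mulr_ge0// ltW.
  by rewrite mul1r ler_wpM2l.
by rewrite mulrBl mulrBr (mulrA alpha) ltr_leD// lerN2.
Qed.

(** W is an orthonormal frame of the orthogonal complement of V and W' a rounded
    version of it: it is enough that the coordinates of u along the rounded
    frame are at most d, which is what a common cell of projections provides. *)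
Lemma in_cone_of_coords m V (W W' : nat -> 'rV[R]_n) : (m < n)%N ->
  (forall j, (j < m)%N -> enorm (W j) = 1) ->
  u + e - \sum_(j < m) dotv (u + e) (W j) *: W j \in V ->
  (forall j, (j < m)%N -> `|dotv u (W' j)| <= d) ->
  (forall j i, (j < m)%N -> `|(W j - W' j) 0 i| <= K%:R^-1) ->
  dist_subspace (u + e) V < alpha * enorm (u + e).
Proof.
move=> mn W1 WV uW' WW'.
apply: le_lt_trans cone_radius.
apply: le_trans (dist_subspace_le_coords W1 WV) _.
apply: (@le_trans _ _ (\sum_(j < m) (d + n%:R * q + n%:R * d))).
  apply: ler_sum => j _.
  have -> : dotv (u + e) (W j) =
      dotv u (W' j) + dotv u (W j - W' j) + dotv e (W j).
    by rewrite dotvDl dotvBr addrCA subrr addr0.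
  apply: le_trans (ler_normD _ _) _; apply: lerD.
    apply: le_trans (ler_normD _ _) _; apply: lerD; first exact: uW'.
    apply: ler_dotv_coord; first by rewrite invr_ge0 ltW.
      exact: coord_le_enorm.
    by move=> i; exact: WW'.
  rewrite -[X in _ <= _ * X]mulr1; apply: ler_dotv_coord => // i.
  by rewrite -(W1 j (ltn_ord j)) coord_le_enorm.
rewrite sumr_const card_ord -[X in X <= _]mulr_natl.
have q0 : 0 < q by exact: lt_le_trans dq.
apply: (@le_trans _ _ (n%:R * (q + n%:R * q + n%:R * q))).
  have nd : 0 <= n%:R * d by rewrite mulr_ge0// ltW.
  have nq : 0 <= n%:R * q by rewrite mulr_ge0// ltW.
  apply: ler_pM; rewrite ?ler0n//; first by move: d0; lra.
    by rewrite ler_nat ltnW.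
  by rewrite !lerD// ler_wpM2l.
by lra.
Qed.

Lemma not_in_half_cone theta : enorm theta = 1 ->
  dotv u theta <= n%:R * q -> dotv (u + e) theta <= alpha * enorm (u + e).
Proof.
move=> t1 ut; apply: ltW; apply: le_lt_trans cone_radius.
rewrite dotvDl; have := dotv_le_enorm e theta; rewrite t1 mulr1 => et.
have n2 : n%:R <= n%:R * n%:R :> R.
  by rewrite -natrM ler_nat; case: (n) => // k; rewrite leq_pmulr.
have q0 : 0 < q by exact: lt_le_trans dq.
have h1 : n%:R * d <= n%:R * q by rewrite ler_wpM2l.
have h2 : n%:R * q <= n%:R * n%:R * q by rewrite ler_pM2r.
have h3 : 0 <= n%:R * q by rewrite mulr_ge0// ltW.
have -> : (2 * n%:R * (n%:R + 1) - n%:R) * q = 2 * (n%:R * n%:R * q) + n%:R * q.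
  by ring.
by move: enorm_e; lra.
Qed.

End Cones.

(** If u and v have almost the same direction, then -u and v are almost
    opposite, and no half-space contains both of them deeply. *)
Lemma opposite_directions (u v theta : 'rV[R]_n) (eps : R) :
  enorm theta = 1 -> 0 < enorm u -> 0 < enorm v -> 0 <= eps ->
  (forall i, `|u 0 i / enorm u - v 0 i / enorm v| <= eps) ->
  dotv (- u) theta <= n%:R * (enorm (- u) * eps) \/
  dotv v theta <= n%:R * (enorm v * eps).
Proof.
move=> t1 u0 v0 eps0 uv.
have h : dotv ((enorm v)^-1 *: v) theta - dotv ((enorm u)^-1 *: u) theta <=
  n%:R * eps.
  rewrite -dotvBl; apply: le_trans (ler_norm _) _.
  rewrite -[X in _ <= _ * X]mulr1; apply: ler_dotv_coord => // i.
    by rewrite !mxE distrC !(mulrC _^-1).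
  by rewrite -t1 coord_le_enorm.
move: h; rewrite !dotvZl => h.
have [?|ut] := leP (dotv (- u) theta) 0.
  by left; apply: le_trans (_ : 0 <= _); rewrite // !mulr_ge0// enorm_ge0.
right; rewrite mulrCA -ler_pdivrMl//; apply: le_trans h.
rewrite lerDl -mulrN pmulr_rge0 ?invr_gt0//.
by move: ut; rewrite dotvNl => /ltW.
Qed.

End Euclid.

(** * Half-open cubes and their subdivision *)

Section Boxes.
Variables (R : realType) (n : nat).
Implicit Types (p x y : 'rV[R]_n) (d l : R).

Definition box p l : set 'rV[R]_n :=
  [set x | forall i, p 0 i <= x 0 i < p 0 i + l].

(** The subcube with index a of the cube box p (N * d) is
    box (p + d *: offset a) d. *)
Definition offset N (a : {ffun 'I_n -> 'I_N}) : 'rV[R]_n :=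
  \row_i (a i : nat)%:R.

Lemma box_diam p l x y : box p l x -> box p l y ->
  forall i, `|(x - y) 0 i| <= l.
Proof.
move=> xp yp i; rewrite !mxE ler_norml.
by have /andP[? ?] := xp i; have /andP[? ?] := yp i; apply/andP; split; lra.
Qed.

Lemma offset_diff N (a b : {ffun 'I_n -> 'I_N}) p d x y : 0 < d ->
  box (p + d *: offset a) d x -> box (p + d *: offset b) d y ->
  forall i, d * ((a i : nat)%:R - (b i : nat)%:R - 1) < x 0 i - y 0 i.
Proof.
move=> d0 xa yb i; have /andP[+ _] := xa i; have /andP[_ +] := yb i.
by rewrite !mxE; lra.
Qed.

Lemma child_sub N (a : {ffun 'I_n -> 'I_N}) p d : 0 < d ->
  box (p + d *: offset a) d `<=` box p (N%:R * d).
Proof.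
move=> d0 x xa i; have := xa i; rewrite !mxE => /andP[h1 h2].
have h3 : 0 <= d * (a i : nat)%:R by rewrite mulr_ge0// ltW.
have h4 : d * (a i : nat)%:R <= d * (N%:R - 1).
  by rewrite ler_pM2l// lerBrDr natr1 ler_nat.
by apply/andP; split; lra.
Qed.

Lemma child_cover N p d x : 0 < d -> box p (N%:R * d) x ->
  exists a : {ffun 'I_n -> 'I_N}, box (p + d *: offset a) d x.
Proof.
move=> d0 xp.
have t0 (i : 'I_n) : 0 <= (x 0 i - p 0 i) / d.
  by rewrite divr_ge0 ?(ltW d0)// subr_ge0; case/andP: (xp i).
have tN (i : 'I_n) : (Num.truncn ((x 0 i - p 0 i) / d)%R < N)%N.
  by rewrite truncn_lt_nat// ltr_pdivrMr// ltrBlDl; case/andP: (xp i).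
exists [ffun i => Ordinal (tN i)] => i; rewrite !mxE ffunE /=.
have /andP[h1 h2] := truncn_itv (t0 i).
move: h1 h2; rewrite ler_pdivlMr// ltr_pdivrMr// -natr1 => h1 h2.
by apply/andP; split; lra.
Qed.

Lemma child_inj N (a b : {ffun 'I_n -> 'I_N}) p d x : 0 < d ->
  box (p + d *: offset a) d x -> box (p + d *: offset b) d x -> a = b.
Proof.
move=> d0 xa xb; apply/ffunP => i; apply/val_inj => /=.
have := offset_diff d0 xa xb i; have := offset_diff d0 xb xa i.
rewrite subrr !pmulr_rlt0// !subr_lt0 !ltrBlDr -!(natrD _ 1) !ltr_nat; lia.
Qed.

(** Keeping only indices in a common residue class modulo K + 1 separates the
    subcubes by K times their side. *)
Lemma child_far N K (a b : {ffun 'I_n -> 'I_N}) p d x y : 0 < d -> a != b ->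
  (forall i, a i = b i %[mod K.+1]) ->
  box (p + d *: offset a) d x -> box (p + d *: offset b) d y ->
  K%:R * d <= enorm (x - y).
Proof.
move=> d0 ab mod_ab xa yb.
have [i abi] : exists i, a i != b i.
  apply/existsP; apply: contraR ab; rewrite negb_exists => /forallP h.
  by apply/eqP/ffunP => i; apply/eqP; have := h i; rewrite negbK.
have abi' : (a i : nat) <> b i by move/val_inj/eqP; rewrite (negbTE abi).
apply: le_trans (coord_le_enorm _ i); rewrite !mxE.
have /eqP := mod_ab i => h.
have := offset_diff d0 xa yb i; have := offset_diff d0 yb xa i.
have [ab_lt|ab_lt] := ltnP (a i) (b i).
  have : (K.+1 <= b i - a i)%N.
    by rewrite dvdn_leq ?subn_gt0// -eqn_mod_dvd ?(ltnW ab_lt)// eq_sym.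
  rewrite leq_subRL ?(ltnW ab_lt)// -(ler_nat R) natrD -natr1 => {}h h1 _.
  have : d * K%:R <= d * ((b i : nat)%:R - (a i : nat)%:R - 1).
    by rewrite ler_pM2l//; lra.
  by rewrite distrC; have := ler_norm (y 0 i - x 0 i); lra.
have {}ab_lt : (b i < a i)%N by rewrite ltn_neqAle ab_lt andbT;
  apply/eqP => /esym.
have : (K.+1 <= a i - b i)%N.
  by rewrite dvdn_leq ?subn_gt0// -eqn_mod_dvd ?(ltnW ab_lt).
rewrite leq_subRL ?(ltnW ab_lt)// -(ler_nat R) natrD -natr1 => {}h _ h1.
have : d * K%:R <= d * ((a i : nat)%:R - (b i : nat)%:R - 1).
  by rewrite ler_pM2l//; lra.
by have := ler_norm (x 0 i - y 0 i); lra.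
Qed.

End Boxes.

(** * Too many cubes force one of them into a cone *)

(** A transitive tournament whose edges are coloured by D has a monochromatic
    path of length two as soon as it has more than 2^|D| vertices: otherwise the
    set of colours leaving a towards later vertices determines a, because the
    colour of (a, b) leaves a but not b. *)
Lemma monochromatic_chain (T C D : finType) (S : {set T}) (cls : T -> C)
    (dir : T -> T -> D) : (#|C| * 2 ^ #|D| < #|S|)%N ->
  exists a b c, [/\ [/\ a \in S, b \in S & c \in S], a != b, b != c,
    cls a = cls b /\ cls b = cls c & dir a b = dir b c].
Proof.
pose later a b := (enum_rank a < enum_rank b)%N && (cls b == cls a).
pose out a := [set dir a b | b in S & later a b]%SET.
move=> largeS.
have [a [b [[aS bS] ab eq_ab eq_out]]] : exists a b,
    [/\ a \in S /\ b \in S, (enum_rank a < enum_rank b)%N, cls a = cls b &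
      out a = out b].
  have : ~~ dinjectiveb (fun a => (cls a, out a)) (mem S).
    apply: contraTN largeS => /dinjectiveP inj; rewrite -leqNgt.
    rewrite -(card_in_imset inj); apply: leq_trans (max_card _) _.
    by rewrite card_prod -[#|{set _}|]cardsT -powersetT card_powerset cardsT.
  case/dinjectivePn => a aS [b]; rewrite !inE => /andP[ba bS] [ecls eout].
  have [h|h|h] := ltngtP (enum_rank a : nat) (enum_rank b).
  - by exists a, b.
  - by exists b, a.
  - by have /enum_rank_inj e := val_inj h; rewrite e eqxx in ba.
have : dir a b \in out a.
  by apply/imsetP; exists b; rewrite // inE bS /later ab eq_ab eqxx.
rewrite eq_out => /imsetP[c]; rewrite inE => /and3P[cS bc /eqP cls_c] dir_c.
exists a, b, c; split=> //.
- by apply: contraTneq ab => ->; rewrite ltnn.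
- by apply: contraTneq bc => ->; rewrite ltnn.
Qed.

Section Pigeonhole.
Variable R : realType.

(** The cell of the real number t when [0, B + 1) is cut into unit intervals. *)
Definition bucket (B : nat) (t : R) : 'I_B.+1 := inord (Num.truncn t).

Lemma bucketE B (t : R) : 0 <= t -> t < B.+1%:R ->
  (bucket B t : nat)%:R <= t < (bucket B t : nat)%:R + 1.
Proof.
move=> t0 tB; rewrite /bucket inordK ?truncn_lt_nat//.
by rewrite natr1; exact: truncn_itv.
Qed.

Lemma bucket_close B (s t : R) :
  0 <= s -> s < B.+1%:R -> 0 <= t -> t < B.+1%:R ->
  bucket B s = bucket B t -> `|s - t| <= 1.
Proof.
move=> s0 sB t0 tB st; have := bucketE s0 sB; have := bucketE t0 tB.
by rewrite st ler_norml => /andP[? ?] /andP[? ?]; apply/andP; split; lra.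
Qed.

Lemma unit_scale_range (K : nat) (w : R) : `|w| <= 1 ->
  0 <= K%:R * (w + 1) /\ K%:R * (w + 1) < (2 * K).+1%:R.
Proof.
rewrite ler_norml => /andP[h1 h2]; have K0 : 0 <= K%:R :> R by [].
split; first by rewrite mulr_ge0//; lra.
have : K%:R * (w + 1) <= K%:R * 2 by rewrite ler_wpM2l//; lra.
by rewrite -(natr1 (2 * K)%N) natrM; lra.
Qed.

Lemma residue_eq (K k l : nat) :
  inord (k %% K.+1) = inord (l %% K.+1) :> 'I_K.+1 -> k = l %[mod K.+1].
Proof. by move=> /(congr1 val); rewrite /= !inordK ?ltn_pmod. Qed.

(** The number of values of the code used in [cone_pigeonhole], factor by
    factor: residues of the index modulo K + 1, rounded frames, cells of the
    projection at scale d, and sets of rounded directions.  Only the third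
    factor depends on N, and it does so like N^m. *)
Definition cone_bound (n m K N : nat) : nat :=
  (K.+1 ^ n * (2 * K).+1 ^ (n * m) * (2 * (n * N)).+1 ^ m *
   2 ^ ((2 * K).+1 ^ n))%N.

Variables (n m N K : nat) (alpha d : R) (p : 'rV[R]_n).
Hypotheses (alpha0 : 0 < alpha) (alpha1 : alpha <= 1) (mn : (m < n)%N).
Hypothesis alphaK : 2 * n%:R * (n%:R + 1) < alpha * K%:R.
Hypothesis d0 : 0 < d.

Let T : finType := {ffun 'I_n -> 'I_N}.
Variables (S : {set T}) (x theta : T -> 'rV[R]_n) (V : T -> {vspace 'rV[R]_n}).
Hypothesis xS : forall a, a \in S -> box (p + d *: offset R a) d (x a).
Hypothesis thetaS : forall a, a \in S -> enorm (theta a) = 1.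
Hypothesis VS : forall a, a \in S -> (\dim (V a) = n - m)%N.

Let K0 : 0 < K%:R :> R.
Proof.
rewrite -(pmulr_rgt0 _ alpha0); apply: le_lt_trans alphaK.
by rewrite !mulr_ge0// addr_ge0.
Qed.

(** A class prescribes the residues of the index of the subcube, the rounding W'
    of an orthonormal frame W of the orthogonal complement of V, and the cell of
    the projection of x along W'.  Points of one class in distinct
    subcubes are far apart compared with d, and their difference, whose
    coordinates along the rounded frame are at most d, is close to V. *)
Lemma nearby_classes : exists (C : finType) (cls : T -> C)
    (W W' : T -> nat -> 'rV[R]_n),
  [/\ #|C| = (K.+1 ^ n * (2 * K).+1 ^ (n * m) * (2 * (n * N)).+1 ^ m)%N,
    forall a, a \in S ->
      [/\ forall j, (j < m)%N -> enorm (W a j) = 1,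
        forall u, u - \sum_(j < m) dotv u (W a j) *: W a j \in V a &
        forall j i, (j < m)%N -> `|(W a j - W' a j) 0 i| <= K%:R^-1] &
    forall a b, a \in S -> b \in S -> cls a = cls b ->
      (forall i, a i = b i %[mod K.+1]) /\
      forall j, (j < m)%N -> `|dotv (x b - x a) (W' a j)| <= d].
Proof.
have Kn0 : K%:R != 0 :> R by rewrite gt_eqF.
pose is_frame a (W : nat -> 'rV[R]_n) :=
  (forall j, (j < m)%N -> enorm (W j) = 1) /\
  forall u, u - \sum_(j < m) dotv u (W j) *: W j \in V a.
have [W HW] : {W : T -> nat -> 'rV[R]_n &
    forall a, a \in S -> is_frame a (W a)}.
  apply: (@choice _ _ (fun a W => a \in S -> is_frame a W)) => a.
  have [aS|aS] := boolP (a \in S); last by exists (fun _ => 0).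
  have [|W [W1 _ W3]] := @orthonormal_complement R n m (V a).
    by rewrite VS// subnK// ltnW.
  by exists W.
pose rcode (a : T) : {ffun 'I_n -> 'I_K.+1} := [ffun i => inord (a i %% K.+1)].
pose wcode a : {ffun 'I_n * 'I_m -> 'I_(2 * K).+1} :=
  [ffun ij : 'I_n * 'I_m => bucket (2 * K) (K%:R * (W a ij.2 0 ij.1 + 1))].
pose frame (c : {ffun 'I_n * 'I_m -> 'I_(2 * K).+1}) (j : nat) : 'rV[R]_n :=
  \row_i (if insub j is Some j' then (c (i, j') : nat)%:R / K%:R - 1 else 0).
have frameE c (j : 'I_m) i : frame c j 0 i = (c (i, j) : nat)%:R / K%:R - 1.
  by rewrite mxE valK.
(* The projection is computed with the rounded frame, which is common to the
   class: only then do equal cells bound the coordinates of a difference. *)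
pose pval a (j : 'I_m) := dotv (x a - p) (frame (wcode a) j) / d + (n * N)%:R.
pose pcode a : {ffun 'I_m -> 'I_(2 * (n * N)).+1} :=
  [ffun j => bucket (2 * (n * N)) (pval a j)].
have W_range y i j : y \in S -> (j < m)%N -> `|W y j 0 i| <= 1.
  by move=> /HW[W1 _] jm; rewrite -(W1 _ jm) coord_le_enorm.
have frame_close y j i : y \in S -> (j < m)%N ->
    `|(W y j - frame (wcode y) j) 0 i| <= K%:R^-1.
  move=> yS jm; pose j' := Ordinal jm.
  rewrite mxE [X in _ + X]mxE (frameE _ j') ffunE /=.
  have [h1 h2] := unit_scale_range K (W_range y i j yS jm).
  have /andP[h3 h4] := bucketE h1 h2.
  set k := (bucket _ _ : nat)%:R in h3 h4 *; set w := W y j 0 i in h3 h4 *.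
  have -> : w - (k / K%:R - 1) = (K%:R * (w + 1) - k) / K%:R.
    by rewrite mulrBl mulrAC divff// mul1r opprB addrA.
  rewrite normrM normfV (gtr0_norm K0) ler_pdivrMr// mulVf//.
  by rewrite ler_norml; apply/andP; split; lra.
have pval_range y j : y \in S ->
    0 <= pval y j /\ pval y j < (2 * (n * N)).+1%:R.
  move=> yS.
  have frame1 i : `|frame (wcode y) j 0 i| <= 1.
    rewrite frameE ler_norml; set c := wcode y (i, j).
    have h : (c : nat)%:R <= 2 * K%:R :> R by rewrite -natrM ler_nat -ltnS.
    have h1 : (c : nat)%:R / K%:R <= 2 :> R by rewrite ler_pdivrMr.
    have h2 : 0 <= (c : nat)%:R / K%:R :> R by rewrite divr_ge0.
    by apply/andP; split; lra.
  have xp i : `|(x y - p) 0 i| <= N%:R * d.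
    have := child_sub d0 (xS yS) i; rewrite !mxE => /andP[? ?].
    have := mulr_ge0 (ler0n R N) (ltW d0).
    by rewrite ler_norml => ?; apply/andP; split; lra.
  have := ler_dotv_coord ler01 xp frame1; rewrite mulr1 mulrA -natrM => h.
  have : `|dotv (x y - p) (frame (wcode y) j) / d| <= (n * N)%:R.
    by rewrite normrM normfV (gtr0_norm d0) ler_pdivrMr.
  rewrite ler_norml => /andP[h1 h2].
  by rewrite /pval -(natr1 (2 * (n * N))%N) (natrM _ 2); split; lra.
exists _, (fun a => (rcode a, wcode a, pcode a)), W, (fun a => frame (wcode a)).
split.
- by rewrite !card_prod !card_ffun !card_prod !card_ord.
- move=> a aS; have [W1 WV] := HW a aS.
  by split => // j i jm; exact: frame_close.
move=> a b aS bS /pair_equal_spec[/pair_equal_spec[er ew] ep]; split.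
  move=> i; apply: residue_eq.
  by have /ffunP/(_ i) := er; rewrite [LHS]ffunE [RHS]ffunE.
move=> j jm; pose j' := Ordinal jm.
have /ffunP/(_ j') := ep; rewrite [LHS]ffunE [RHS]ffunE => e.
have [h1 h2] := pval_range _ j' aS; have [h3 h4] := pval_range _ j' bS.
have := bucket_close h1 h2 h3 h4 e.
rewrite /pval -ew opprD addrACA subrr addr0 -mulrBl -dotvBl normrM normfV.
rewrite (gtr0_norm d0) ler_pdivrMr// mul1r -normrN -dotvNl opprB.
by rewrite opprB addrA subrK.
Qed.

(** Colour each pair of points by its rounded direction.  Three points a, b, c
    of one class with the same direction from a to b as from b to c are almost
    aligned, so that the cube of a or that of c avoids the half-cone at b. *)
Lemma cone_pigeonhole : (cone_bound n m K N < #|S|)%N ->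
  exists a b, [/\ a \in S, b \in S &
    box (p + d *: offset R b) d `<=`
    bounded_cone (x a) (n%:R * (N%:R * d)) (V a) alpha
      `\` half_cone (x a) (theta a) alpha].
Proof.
have [C [cls [W [W' [cardC frameS clsS]]]]] := nearby_classes.
pose udir a b i := (x b - x a) 0 i / enorm (x b - x a).
pose dir (a b : T) : {ffun 'I_n -> 'I_(2 * K).+1} :=
  [ffun i => bucket (2 * K) (K%:R * (udir a b i + 1))].
have -> : cone_bound n m K N = (#|C| * 2 ^ #|{ffun 'I_n -> 'I_(2 * K).+1}|)%N.
  by rewrite cardC card_ffun !card_ord.
move=> /(monochromatic_chain cls dir)[a [b [c [[aS bS cS] ab bc [eab ebc]
  edir]]]].
have far y z : y \in S -> z \in S -> y != z -> cls y = cls z ->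
    K%:R * d <= enorm (x z - x y).
  move=> yS zS yz e; apply: child_far d0 _ _ (xS zS) (xS yS).
    by rewrite eq_sym.
  by move=> i; rewrite (clsS _ _ yS zS e).1.
have far_gt0 y z : y \in S -> z \in S -> y != z -> cls y = cls z ->
    0 < enorm (x z - x y).
  move=> yS zS yz e; apply: lt_le_trans (far _ _ yS zS yz e).
  exact: mulr_gt0.
have udir_range y z i : y \in S -> z \in S -> y != z -> cls y = cls z ->
    `|udir y z i| <= 1.
  move=> yS zS yz e; have pos := far_gt0 _ _ yS zS yz e.
  by rewrite normrM normfV (gtr0_norm pos) ler_pdivrMr// mul1r coord_le_enorm.
have udir_close i : `|udir a b i - udir b c i| <= K%:R^-1.
  have [h1 h2] := unit_scale_range K (udir_range a b i aS bS ab eab).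
  have [h3 h4] := unit_scale_range K (udir_range b c i bS cS bc ebc).
  have /ffunP/(_ i) := edir; rewrite [LHS]ffunE [RHS]ffunE => e.
  have := bucket_close h1 h2 h3 h4 e.
  rewrite -mulrBr opprD addrACA subrr addr0 normrM (gtr0_norm K0) mulrC.
  by rewrite -ler_pdivlMr// div1r.
have conclude y z : y \in S -> z \in S -> y != z -> cls y = cls z ->
    dotv (x z - x y) (theta y) <= n%:R * (enorm (x z - x y) / K%:R) ->
    exists a b, [/\ a \in S, b \in S &
      box (p + d *: offset R b) d `<=`
      bounded_cone (x a) (n%:R * (N%:R * d)) (V a) alpha
        `\` half_cone (x a) (theta a) alpha].
  move=> yS zS yz e h; exists y, z; split => // w wz.
  have wE : w - x y = (x z - x y) + (w - x z).
    by rewrite [RHS]addrC addrA subrK.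
  have [W1 WV WW'] := frameS _ yS; have [_ cW'] := clsS _ _ yS zS e.
  have small := box_diam wz (xS zS); have yz_far := far _ _ yS zS yz e.
  split; last first.
    rewrite /half_cone /= wE; apply/negP; rewrite -leNgt.
    exact: (not_in_half_cone alpha0 alpha1 alphaK d0 yz_far small (thetaS yS)
      h).
  split; last first.
    rewrite /cone /= wE.
    exact: (in_cone_of_coords alpha0 alpha1 alphaK d0 yz_far small mn W1 (WV _)
      cW' WW').
  rewrite /eball /=; apply: enorm_le_coord => i.
  exact: box_diam (child_sub d0 wz) (child_sub d0 (xS yS)) i.
have Kinv0 : 0 <= K%:R^-1 :> R by rewrite invr_ge0 ltW.
have [h|h] := opposite_directions (thetaS bS) (far_gt0 _ _ aS bS ab eab)
  (far_gt0 _ _ bS cS bc ebc) Kinv0 udir_close; last exact: (conclude b c).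
apply: (conclude b a) => //; first by rewrite eq_sym.
by rewrite opprB in h.
Qed.

End Pigeonhole.

(** * Borel sets and finite additivity *)

Section Borel.
Variables (R : realType) (n : nat).
Local Notation E := 'rV[R]_n.
Local Notation B := (g_sigma_algebraType [set U : set E | open U]).

Lemma borelE (A : set E) : borel_sets A = measurable (A : set B).
Proof. by []. Qed.

Lemma borel_open (A : set E) : open A -> borel_sets A.
Proof. exact: sub_sigma_algebra. Qed.

Lemma borelC (A : set E) : borel_sets A -> borel_sets (~` A).
Proof. by rewrite !borelE; exact: measurableC. Qed.

Lemma borelI (A A' : set E) : borel_sets A -> borel_sets A' ->
  borel_sets (A `&` A').
Proof. by rewrite !borelE; exact: measurableI. Qed.

Lemma borelD (A A' : set E) : borel_sets A -> borel_sets A' ->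
  borel_sets (A `\` A').
Proof. by rewrite !borelE; exact: measurableD. Qed.

Lemma borel_bigcup (F : nat -> set E) : (forall i, borel_sets (F i)) ->
  borel_sets (\bigcup_i F i).
Proof. by move=> h; rewrite borelE; apply: bigcupT_measurable. Qed.

Lemma borel_bigcup_fin (I : finType) (P : set I) (F : I -> set E) :
  (forall i, borel_sets (F i)) -> borel_sets (\bigcup_(i in P) F i).
Proof.
move=> h; rewrite borelE; apply: fin_bigcup_measurable => [|i _]; last exact: h.
exact: finite_finset.
Qed.

Lemma borel_limsup (F : nat -> set E) : (forall i, borel_sets (F i)) ->
  borel_sets (lim_sup_set F).
Proof.
move=> h; rewrite borelE; apply: bigcapT_measurable => i.
by apply: bigcup_measurable => j _; exact: h.
Qed.

Lemma borel_box (p : E) (l : R) : borel_sets (box p l).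
Proof.
have lt_open (i : 'I_n) (c : R) : open [set x : E | x 0 i < c].
  apply: (@open_comp E R (fun x : E => x 0 i) [set r | r < c]);
    last exact: open_lt.
  by move=> x _; exact: coord_continuous.
have -> : box p l = \bigcap_(i in [set: 'I_n])
    (~` [set x : E | x 0 i < p 0 i] `&` [set x : E | x 0 i < p 0 i + l]).
  apply/seteqP; split=> [x xp i _ /=|x xp i]; last first.
    have [/= /negP] := xp i I; rewrite -leNgt => h1 h2.
    exact/andP.
  by have /andP[h1 h2] := xp i; split => //; apply/negP; rewrite -leNgt.
rewrite borelE; apply: fin_bigcap_measurable => [|i _];
  first exact: finite_finset.
by apply: borelI; [apply: borelC|]; exact: borel_open.
Qed.

End Borel.

Section Mass.
Variables (R : realType) (n : nat).
Local Notation E := 'rV[R]_n.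
Variable mu : {outer_measure set E -> \bar R}.
Hypothesis mu_meas : is_measure mu.

Definition mass (A : set E) : R := fine (mu A).

Lemma cara_borel A : borel_sets A -> mu.-caratheodory A.
Proof. by case: mu_meas => -[h _] _ _; exact: h. Qed.

Lemma mu_fin A : mu A \is a fin_num.
Proof.
case: mu_meas => _ h _; rewrite ge0_fin_numE ?outer_measure_ge0//.
by apply: le_lt_trans h; exact: le_outer_measure.
Qed.

Lemma massE A : mu A = (mass A)%:E.
Proof. by rewrite fineK// mu_fin. Qed.

Lemma mass_ge0 A : 0 <= mass A.
Proof. by rewrite fine_ge0// outer_measure_ge0. Qed.

Lemma le_mass A A' : A `<=` A' -> mass A <= mass A'.
Proof. by move=> h; rewrite -lee_fin -!massE le_outer_measure. Qed.

Lemma mass0 : mass set0 = 0.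
Proof. by rewrite /mass outer_measure0. Qed.

Lemma massU A A' : mass (A `|` A') <= mass A + mass A'.
Proof. by rewrite -lee_fin EFinD -!massE outer_measureU2. Qed.

Lemma mass_bigcup_le (I : eqType) (s : seq I) (A : set E) (F : I -> set E) :
  (forall x, A x -> exists2 i, i \in s & F i x) ->
  mass A <= \sum_(i <- s) mass (F i).
Proof.
elim: s A => [|i s IH] A cov.
  rewrite big_nil; apply: le_trans (le_mass (_ : A `<=` set0)) _;
    last by rewrite mass0.
  by move=> x /cov[].
rewrite big_cons; apply: (@le_trans _ _ (mass (F i `|` (A `\` F i)))).
  by apply: le_mass => x Ax; have [Fx|Fx] := pselect (F i x); [left|right].
apply: le_trans (massU _ _) _; rewrite lerD2l; apply: IH => x [Ax Fx].
have [j] := cov _ Ax; rewrite inE => /orP[/eqP -> //|js Fjx]; by exists j.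
Qed.

Lemma massIU (X A A' : set E) : borel_sets A -> A `&` A' = set0 ->
  mass (X `&` A) + mass (X `&` A') <= mass (X `&` (A `|` A')).
Proof.
move=> bA AA'; rewrite -lee_fin EFinD -!massE.
rewrite [leRHS](cara_borel bA) leeD// le_outer_measure//.
  by move=> x [Xx Ax]; split=> //; split=> //; left.
move=> x [Xx A'x]; split; first by split=> //; right.
by move=> Ax; have : (A `&` A') x by []; rewrite AA'.
Qed.

Lemma mass_disjoint (I : eqType) (s : seq I) (X A : set E) (F : I -> set E) :
  uniq s -> (forall i, i \in s -> borel_sets (F i)) ->
  (forall i, i \in s -> F i `<=` A) ->
  (forall i j, i \in s -> j \in s -> F i `&` F j !=set0 -> i = j) ->
  \sum_(i <- s) mass (X `&` F i) <= mass (X `&` A).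
Proof.
elim: s A => [|i s IH] A; first by rewrite big_nil mass_ge0.
move=> /= /andP[nis us] bF FA disj; rewrite big_cons.
have is_ : i \in i :: s by rewrite mem_head.
have ss j : j \in s -> j \in i :: s by rewrite inE => ->; rewrite orbT.
apply: (@le_trans _ _ (mass (X `&` F i) + mass (X `&` (A `\` F i)))).
  rewrite lerD2l; apply: IH => //.
  - by move=> j /ss; exact: bF.
  - move=> j js x Fx; split; first exact: FA (ss _ js) _ Fx.
    move=> Fix_; suff ij : i = j by rewrite ij js in nis.
    by apply: disj => //; [exact: ss|exists x].
  - by move=> j k /ss js /ss ks; exact: disj.
apply: le_trans (massIU _ (bF _ is_) _) _;
  first by rewrite setDE setICA setICr setI0.
by rewrite setDUK//; exact: FA.
Qed.

(** Continuity from above along the unions of the tails, as mu is finite. *)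
Lemma mass_limsup (F : nat -> set E) (c : R) : (forall k, borel_sets (F k)) ->
  (forall k, c <= mass (F k)) -> c <= mass (lim_sup_set F).
Proof.
move=> bF cF; rewrite -lee_fin -massE.
have := @lim_sup_set_cvg _ (caratheodory_type mu) R mu F
  (fun k => cara_borel (bF k)).
have -> : (mu (\bigcup_(k in [set k | (0 <= k)%N]) F k) < +oo)%E.
  by rewrite ltey_eq mu_fin.
move=> /(_ isT) cv; rewrite -(cvg_lim _ cv)//; apply: lime_ge;
  first by apply/cvg_ex; eexists; exact: cv.
apply: nearW => k; apply: (@le_trans _ _ (mu (F k)));
  first by rewrite massE lee_fin.
by apply: le_outer_measure => x Fx; exists k => /=.
Qed.

Lemma mass_limsup0 (F : nat -> set E) (c : R) : 0 < c ->
  (forall k, borel_sets (F k)) -> lim_sup_set F = set0 ->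
  exists k0, forall k, (k0 <= k)%N -> mass (F k) <= c.
Proof.
move=> c0 bF F0.
have := @lim_sup_set_cvg _ (caratheodory_type mu) R mu F
  (fun k => cara_borel (bF k)).
have -> : (mu (\bigcup_(k in [set k | (0 <= k)%N]) F k) < +oo)%E.
  by rewrite ltey_eq mu_fin.
move=> /(_ isT); rewrite F0 /= outer_measure0 => cv.
have /fine_cvgP[_ /cvgrPdist_le /(_ _ c0)[k0 _ h]] := cv.
exists k0 => k k0k; apply: le_trans (h k k0k).
rewrite sub0r normrN ger0_norm; last exact: mass_ge0.
by apply: le_mass => x Fx; exists k => /=.
Qed.

End Mass.

(** * Regularity of finite Borel measures *)

Section Regularity.
Variables (R : realType) (n : nat).
Local Notation E := 'rV[R]_n.
Variable mu : {outer_measure set E -> \bar R}.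
Hypothesis mu_meas : is_measure mu.

Definition regular (B : set E) : Prop := forall e : R, 0 < e ->
  exists F U,
    [/\ closed F, open U, F `<=` B, B `<=` U & mass mu (U `\` F) <= e].

(** An open set is exhausted by the closed sets of points at distance at least
    1 / (k + 1) from its complement. *)
Lemma regular_open U : open U -> regular U.
Proof.
move=> oU e e0; pose r k : R := k.+1%:R^-1.
have r0 k : 0 < r k by rewrite invr_gt0.
pose O k := \bigcup_(y in ~` U) ball y (r k).
have oO k : open (O k) by apply: bigcup_open => y _; exact: ball_open.
have OF k : ~` O k `<=` U.
  by move=> x Ox; apply: contrapT => Ux; apply: Ox; exists x => //;
    exact: ballxx.
have D0 : lim_sup_set (fun k => U `\` ~` O k) = set0.
  rewrite -subset0 => x /= xD.
  have [Ux _] : (U x /\ True) by have [j _ []] := xD 0%N I.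
  have /nbhs_ballP[d /= d0 dU] := open_nbhs_nbhs (conj oU Ux).
  have /cvgrPdist_lt/(_ _ d0)[N _ hN] := @cvg_harmonic R.
  have [j /= Nj [_ /contrapT[y yU xy]]] := xD N I.
  apply: yU; apply: dU; apply: le_ball (ball_sym xy).
  by have := hN j Nj; rewrite /= sub0r normrN ger0_norm ?invr_ge0// => /ltW.
have [|k0 hk] := mass_limsup0 mu_meas e0 _ D0.
  by move=> k; apply: borelD; [|apply: borelC]; exact: borel_open.
by exists (~` O k0), U; split=> //; [exact: open_closedC | exact: hk].
Qed.

Lemma regularC B : regular B -> regular (~` B).
Proof.
move=> rB e /rB[F [U [cF oU FB BU h]]]; exists (~` U), (~` F); split.
- exact: open_closedC.
- exact: closed_openC.
- exact: subsetC.
- exact: subsetC.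
- by rewrite setDE setCK setIC -setDE.
Qed.

(** Inner approximations are truncated to a finite union, in order to remain
    closed; the truncation costs half of the allowed error. *)
Lemma regular_bigcup (B : nat -> set E) : (forall i, regular (B i)) ->
  regular (\bigcup_i B i).
Proof.
move=> rB e e0; pose ei (i : nat) := e / 2 / (2 ^ i.+1)%:R.
have ei0 i : 0 < ei i by rewrite !divr_gt0// ltr0n expn_gt0.
have /choice[F /choice[U FU]] := fun i => rB i (ei i) (ei0 i).
pose UU := \bigcup_i U i.
pose FF k := \bigcup_(i in `I_k) F i.
have cF k : closed (FF k).
  apply: closed_bigcup => [|i _]; first exact: finite_II.
  by have [] := FU i.
have oUU : open UU by apply: bigcup_open => i _; have [] := FU i.
pose FFF := \bigcup_i F i.
have bF i : borel_sets (F i).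
  by rewrite -[F i]setCK; apply: borelC; apply: borel_open; apply: closed_openC;
    have [] := FU i.
have bFFF : borel_sets FFF by exact: borel_bigcup.
have D0 : lim_sup_set (fun k => FFF `\` FF k) = set0.
  rewrite -subset0 => x /= xD.
  have [i _ Fix_] : FFF x by have [j _ []] := xD 0%N I.
  have [j /= ij [_]] := xD i.+1 I; apply.
  by exists i.
have e20 : 0 < e / 2 by rewrite divr_gt0.
have [|k0 hk] := mass_limsup0 mu_meas e20 _ D0.
  move=> k; apply: borelD => //; rewrite -[FF k]setCK; apply: borelC.
  by apply: borel_open; apply: closed_openC.
exists (FF k0), UU; split => //.
- by move=> x [i _ Fx]; exists i => //; have [_ _ + _ _] := FU i; apply.
- by move=> x [i _ Fx]; exists i => //; have [_ _ _ + _] := FU i; apply.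
apply: (@le_trans _ _ (mass mu ((UU `\` FFF) `|` (FFF `\` FF k0)))).
  apply: le_mass => // x [Ux Fx].
  by have [?|?] := pselect (FFF x); [right|left].
apply: le_trans (massU mu_meas _ _) _; rewrite [leRHS]splitr lerD ?hk//.
rewrite -lee_fin -massE//.
apply: (@le_trans _ _ (mu (\bigcup_i (U i `\` F i)))).
  by apply: le_outer_measure => x [[i _ Uix] nF]; exists i => //;
    split => // Fx; apply: nF; exists i.
apply: le_trans (outer_measure_sigma_subadditive mu _) _.
apply: le_trans (_ : \sum_(0 <= i <oo) (ei i)%:E <= _)%E.
  apply: lee_nneseries => i _; first by move=> ?; exact: outer_measure_ge0.
  by rewrite massE// lee_fin; have [] := FU i.
exact: epsilon_trick0 (ltW e20).
Qed.

Lemma regular_borel B : borel_sets B -> regular B.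
Proof.
move=> bB; apply: (smallest_sub _ _ bB); last by move=> U; exact: regular_open.
split.
- by apply: regular_open; exact: open0.
- by move=> A /regularC; rewrite setTD.
- exact: regular_bigcup.
Qed.

Lemma open_hull (A : set E) : 0 < mass mu A ->
  exists U, [/\ open U, A `<=` U & mass mu U <= 2 * mass mu A].
Proof.
move=> A0; case: (mu_meas) => -[_ /(_ A)[B [bB AB BA]]] _ _.
have [F [U [_ oU FB BU h]]] := regular_borel bB A0.
exists U; split => //; first exact: subset_trans BU.
apply: (@le_trans _ _ (mass mu (B `|` (U `\` F)))).
  apply: le_mass => // x Ux; have [Bx|Bx] := pselect (B x); first by left.
  by right; split => // /FB.
apply: le_trans (massU mu_meas _ _) _.
have -> : mass mu B = mass mu A by rewrite /mass BA.
by lra.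
Qed.

End Regularity.

(** * Halos of cubes and cubes of positive density *)

Section Halo.
Variables (R : realType) (n : nat).
Local Notation E := 'rV[R]_n.
Variable mu : {outer_measure set E -> \bar R}.
Hypothesis mu_meas : is_measure mu.

(** The halo contains the balls of radius n * d centred in the cube.  It is
    itself a union of (2n+1)^n cubes of side d, which gives its bounded overlap
    for free. *)
Definition halo (p : E) (d : R) : set E :=
  box (p - const_mx (n%:R * d)) ((2 * n).+1%:R * d).

Lemma in_halo p d x y : box p d x -> (forall i, `|(y - x) 0 i| <= n%:R * d) ->
  halo p d y.
Proof.
move=> xp yx i; have := yx i; have := xp i.
rewrite !mxE -(natr1 (2 * n)%N) natrM ler_norml => /andP[? ?] /andP[? ?].
by apply/andP; split; lra.
Qed.

Lemma halo_near p d x y : box p d x -> halo p d y ->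
  forall i, `|(y - x) 0 i| <= (n%:R + 1) * d.
Proof.
move=> xp yp i; have := yp i; have := xp i.
rewrite !mxE -(natr1 (2 * n)%N) natrM ler_norml => /andP[? ?] /andP[? ?].
by apply/andP; split; lra.
Qed.

Lemma halo_child N (a : {ffun 'I_n -> 'I_N}) p d : 0 < d ->
  halo (p + d *: offset R a) d `<=` halo p (N%:R * d).
Proof.
move=> d0 x xa i; have := xa i; rewrite !mxE -(natr1 (2 * n)%N) natrM =>
  /andP[h1 h2].
have h3 : 0 <= d * (a i : nat)%:R by rewrite mulr_ge0// ltW.
have h4 : d * (a i : nat)%:R <= d * (N%:R - 1).
  by rewrite ler_pM2l// lerBrDr natr1 ler_nat.
have h5 : n%:R * d <= n%:R * (N%:R * d).
  rewrite ler_wpM2l// ler_peMl// ?ler1n ?ltW//.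
  exact: leq_ltn_trans (ltn_ord (a i)).
by apply/andP; split; lra.
Qed.

(** Cut each halo into translates of its cube.  For a fixed translation the
    translated cubes remain pairwise disjoint, so that their total mass is at
    most that of U. *)
Lemma halo_overlap (I : eqType) (s : seq I) (p : I -> E) (d : R) (U : set E) :
  0 < d -> uniq s ->
  (forall i j x, i \in s -> j \in s -> box (p i) d x -> box (p j) d x ->
    i = j) ->
  (forall i, i \in s -> halo (p i) d `<=` U) ->
  \sum_(i <- s) mass mu (halo (p i) d) <= ((2 * n).+1 ^ n)%:R * mass mu U.
Proof.
move=> d0 us disj sub.
pose q (i : I) (a : {ffun 'I_n -> 'I_(2 * n).+1}) : E :=
  p i - const_mx (n%:R * d) + d *: offset R a.
apply: (@le_trans _ _ (\sum_(i <- s) \sum_a mass mu (box (q i a) d))).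
  apply: ler_sum => i _; rewrite -big_enum; apply: mass_bigcup_le => // x xh.
  by have [a xa] := child_cover d0 xh; exists a; rewrite ?mem_enum.
rewrite exchange_big /= mulr_natl.
have -> : ((2 * n).+1 ^ n)%N = #|{ffun 'I_n -> 'I_(2 * n).+1}|.
  by rewrite card_ffun !card_ord.
rewrite -sumr_const; apply: ler_sum => a _.
under eq_bigr do rewrite -[box _ _]setTI; rewrite -[U]setTI.
apply: mass_disjoint => //.
- by move=> i _; exact: borel_box.
- by move=> i is_; apply: subset_trans (sub i is_); exact: child_sub.
- move=> i j is_ js [x [xi xj]].
  pose v := - const_mx (n%:R * d) + d *: offset R a.
  have shift k : box (q k a) d x -> box (p k) d (x - v).
    by move=> xk l; have := xk l; rewrite !mxE => /andP[? ?]; apply/andP; split;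
      lra.
  by apply: disj is_ js (shift _ xi) (shift _ xj).
Qed.

Lemma mass_exhaust (A : set E) (F : nat -> set E) : 0 < mass mu A ->
  (forall x, A x -> exists k, F k x) -> exists k, 0 < mass mu (A `&` F k).
Proof.
move=> A0 covF; apply: contrapT => /forallNP h.
have : (mu A <= 0)%E.
  apply: (@le_trans _ _ (\sum_(0 <= k <oo) mu (A `&` F k))%E).
    apply: le_trans (outer_measure_sigma_subadditive mu _).
    by apply: le_outer_measure => x Ax; have [k xk] := covF x Ax; exists k.
  rewrite eseries0// => k _ _; rewrite massE//; congr (_%:E).
  by apply/eqP; rewrite eq_le mass_ge0 andbT leNgt; apply/negP; exact: h.
by rewrite massE// lee_fin leNgt A0.
Qed.

Lemma bounded_part (A : set E) : 0 < mass mu A ->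
  exists p l, 0 < l /\ 0 < mass mu (A `&` box p l).
Proof.
move=> A0.
pose Q (k : nat) := box (const_mx (- k%:R) : E) (2 * k%:R).
have covQ x : exists k, Q k x.
  exists (Num.truncn (enorm x)).+1 => i; have := truncnS_gt (enorm x).
  have := coord_le_enorm x i; rewrite !mxE ler_norml => /andP[? ?] ?.
  by apply/andP; split; lra.
have [k Ak] := mass_exhaust A0 (fun x _ => covQ x).
case: k Ak => [|k] Ak; last first.
  by exists (const_mx (- k.+1%:R)), (2 * k.+1%:R); rewrite mulr_gt0.
exists (const_mx (- 0%:R)), 1; split => //; apply: lt_le_trans Ak _.
apply: le_mass => // x [Ax xQ]; split=> // i; have := xQ i.
by rewrite !mxE => /andP[? ?]; apply/andP; split; lra.
Qed.

(** Otherwise every small cube Q with halo Q inside an open set U around A has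
    mass (A `&` Q) at most mass (halo Q) / (8 (2n+1)^n).  Summing over the cubes
    of one level gives at most mass U / 8 <= mass A / 4, although at fine levels
    these cubes cover all of A except a part of mass at most mass A / 2. *)
Lemma dense_box (A : set E) (h0 : R) : 0 < mass mu A -> 0 < h0 ->
  exists p l, [/\ 0 < l, l <= h0 &
    mass mu (halo p l) < (8 * (2 * n).+1 ^ n)%:R * mass mu (A `&` box p l)].
Proof.
move=> A0 h00; have [p [l [l0 Al]]] := bounded_part A0.
pose A' := A `&` box p l; have [U [oU AU mU]] := open_hull mu_meas Al.
pose d (k : nat) := l / k.+1%:R.
have d0 k : 0 < d k by rewrite divr_gt0.
have dE k : k.+1%:R * d k = l by rewrite mulrC mulfVK.
pose T (k : nat) : finType := {ffun 'I_n -> 'I_k.+1}.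
pose q k (a : T k) := p + d k *: offset R a.
pose G k : {set T k} := [set a : T k | `[< halo (q k a) (d k) `<=` U >] ]%SET.
pose G' k := \bigcup_(a in [set` G k]) box (q k a) (d k).
(* D k is the part of U missed by the cubes of side l / (k + 1) whose halo lies
   in U; each point of U is missed at finitely many scales only. *)
pose D k := (U `&` box p l) `\` G' k.
have bD k : borel_sets (D k).
  apply: borelD; first by apply: borelI; [exact: borel_open|exact: borel_box].
  by apply: borel_bigcup_fin => a; exact: borel_box.
have dcv (e : R) : 0 < e -> exists k0, forall k, (k0 <= k)%N -> d k < e.
  move=> e0; have el0 : 0 < e / l by rewrite divr_gt0.
  have /cvgrPdist_lt/(_ _ el0)[N _ hN] := @cvg_harmonic R.
  exists N => k Nk; have := hN k Nk.
  rewrite /= sub0r normrN ger0_norm ?invr_ge0// ltr_pdivlMr//.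
  by rewrite /d mulrC.
have D0 : lim_sup_set D = set0.
  rewrite -subset0 => x /= xD.
  have [Ux xp] : (U `&` box p l) x by have [j _ []] := xD 0%N I.
  have /nbhs_ballP[e /= e0 eU] := open_nbhs_nbhs (conj oU Ux).
  have ne0 : 0 < e / (n%:R + 1) by rewrite divr_gt0// ltr_wpDl.
  have [k0 hk0] := dcv _ ne0.
  have [k /= k0k [_]] := xD k0 I; apply.
  have : box p (k.+1%:R * d k) x by rewrite dE.
  move=> /(child_cover (d0 k))[a xa]; exists a => //=.
  rewrite inE; apply/asboolP => y /(halo_near xa) yx; apply: eU.
  split=> // i j; rewrite ord1 /ball /= distrC.
  have := yx j; rewrite !mxE => /le_lt_trans; apply.
  by have := hk0 k k0k; rewrite ltr_pdivlMr ?ltr_wpDl// mulrC.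
have hA : 0 < mass mu A' / 2 by rewrite divr_gt0.
have [k1 hk1] := mass_limsup0 mu_meas hA bD D0.
have [k2 hk2] := dcv _ h00.
pose k := maxn k1 k2.
have {}hk1 := hk1 k (leq_maxl _ _); have {}hk2 := hk2 k (leq_maxr _ _).
have covA : mass mu A' <= \sum_(a in G k) mass mu (A' `&` box (q k a) (d k)) +
  mass mu (D k).
  apply: (@le_trans _ _ (mass mu ((A' `&` G' k) `|` D k))).
    apply: le_mass => // x A'x; have [xG|xG] := pselect (G' k x);
      [by left|right].
    by split => //; split; [exact: AU|case: A'x].
  apply: le_trans (massU mu_meas _ _) _; rewrite lerD2r -big_enum.
  apply: mass_bigcup_le => // x [A'x [a aG xa]]; exists a => //.
  by rewrite mem_enum.
have ovG : \sum_(a in G k) mass mu (halo (q k a) (d k)) <=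
  ((2 * n).+1 ^ n)%:R * mass mu U.
  rewrite -big_enum; apply: halo_overlap => //.
  - exact: enum_uniq.
  - by move=> a b x _ _; exact: child_inj.
  - by move=> a; rewrite mem_enum inE => /asboolP.
have [[a [aG ha]]|nex] := pselect (exists a, a \in G k /\
    mass mu (halo (q k a) (d k)) <
    (8 * (2 * n).+1 ^ n)%:R * mass mu (A' `&` box (q k a) (d k))).
  exists (q k a), (d k); split=> //; first exact: ltW.
  apply: lt_le_trans ha _; rewrite ler_wpM2l// le_mass// => x [[Ax _] xa].
  by split.
have hsum : (8 * (2 * n).+1 ^ n)%:R *
      \sum_(a in G k) mass mu (A' `&` box (q k a) (d k)) <=
    \sum_(a in G k) mass mu (halo (q k a) (d k)).
  rewrite mulr_sumr; apply: ler_sum => a aG; rewrite leNgt; apply/negP => ha.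
  by apply: nex; exists a.
have P0 : 0 < ((2 * n).+1 ^ n)%:R :> R by rewrite ltr0n expn_gt0.
have := le_trans hsum ovG; rewrite natrM -mulrA mulrCA ler_pM2l// => h.
by move: covA hk1 mU hA h; rewrite -/A'; lra.
Qed.

End Halo.

(** * Upper limits with vanishing Hausdorff measure *)

Section Hausdorff.
Variables (R : realType) (n : nat).
Local Notation E := 'rV[R]_n.
Implicit Types (A : set E) (t r : R).
Local Open Scope ereal_scope.

Lemma diam_ge0 A : A !=set0 -> 0 <= diam A.
Proof.
move=> [x Ax]; apply: ereal_sup_ubound; exists x => //; exists x => //.
by rewrite subrr -(scale0r (0%R : E)) enormZ normr0 mul0r.
Qed.

Lemma diam_pow_ge0 t A : 0 <= diam_pow t A.
Proof. by rewrite /diam_pow; case: ifP => // _; exact: poweR_ge0. Qed.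

Lemma diam_pow_le t r A : (0 <= t)%R -> (0 <= r)%R -> diam A <= r%:E ->
  diam_pow t A <= (r `^ t)%:E.
Proof.
move=> t0 r0 Ar; rewrite /diam_pow; case: ifPn => [_|/set0P A0].
  by rewrite lee_fin powR_ge0.
rewrite -poweR_EFin; apply: gt0_ler_poweR => //.
  by rewrite in_itv /= diam_ge0//= leey.
by rewrite in_itv /= lee_fin r0 leey.
Qed.

Lemma diam_box_le (p : E) (l : R) : diam (box p l) <= (n%:R * l)%:E.
Proof.
apply: ge_ereal_sup => _ [x xp [y yp <-]]; rewrite lee_fin.
by apply: enorm_le_coord; exact: box_diam.
Qed.

Lemma diam_set0_le (r : R) : diam (set0 : set E) <= r%:E.
Proof. by apply: ge_ereal_sup => _ [x []]. Qed.

Lemma sum_diam_pow_le t r (s : seq (set E)) : (0 <= t)%R -> (0 <= r)%R ->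
  (forall A, A \in s -> diam A <= r%:E) ->
  \sum_(0 <= j <oo) diam_pow t (nth set0 s j) <= ((size s)%:R * (r `^ t))%:E.
Proof.
move=> t0 r0 sr; rewrite (@nneseries_split _ _ 0 (size s)); last first.
  by move=> k _; exact: diam_pow_ge0.
rewrite add0n [X in _ + X]eseries0 ?adde0; last first.
  by move=> i si _; rewrite nth_default// /diam_pow eqxx.
rewrite big_mkord mulr_natl -[X in (_ *+ X)%R]card_ord -sumr_const.
rewrite -sumEFin; apply: lee_sum => j _; apply: diam_pow_le => //.
by apply: sr; rewrite mem_nth.
Qed.

(** For every L2 the upper limit is covered by the members of F L, L >= L2.  The
    t-sums of these covers are tails of a geometric series. *)
Lemma hausdorff_limsup_null t a (F : nat -> seq (set E)) (r : nat -> R) :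
  (0 <= t)%R -> (forall L, 0 <= r L)%R ->
  (forall L A, A \in F L -> diam A <= (r L)%:E) ->
  (forall delta, 0 < delta ->
    exists L0, forall L, (L0 <= L)%N -> r L <= delta)%R ->
  (forall L, (size (F L))%:R * r L `^ t <= a / (2 ^ L.+1)%:R)%R ->
  hausdorff_measure t (lim_sup_set (fun L => \bigcup_(A in [set` F L]) A)) = 0.
Proof.
move=> t0 r0 Fr r_to0 size_F; set X := lim_sup_set _.
suff pre0 (delta : R) : (0 < delta)%R -> hausdorff_premeasure t delta X <= 0.
  apply/eqP; rewrite eq_le; apply/andP; split.
    by apply: ge_ereal_sup => _ [delta d0 <-]; exact: pre0.
  apply: le_trans (_ : hausdorff_premeasure t 1 X <= _); last first.
    by apply: ereal_sup_ubound; exists 1%R => //=.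
  apply: le_ereal_inf_tmp => _ [G _ <-]; apply: nneseries_ge0 => i _ _.
  exact: diam_pow_ge0.
move=> d0; apply/lee_addgt0Pr => e e0; rewrite add0e.
have a0 : (0 <= a)%R.
  have := size_F 0%N; rewrite -(@pmulr_lge0 _ (2 ^ 1)%:R^-1)%R ?invr_gt0//.
  by apply: le_trans; rewrite mulr_ge0// powR_ge0.
have [L0 hL0] := r_to0 _ d0.
(* L0 makes the members of the cover small, L1 makes the tail small. *)
have [L1 hL1] : exists L1 : nat, (a / (2 ^ L1)%:R <= e)%R.
  exists (Num.truncn (a / e)).+1; rewrite ler_pdivrMr ?ltr0n ?expn_gt0//
    -ler_pdivrMl//.
  rewrite mulrC; apply: le_trans (ltW (truncnS_gt _)) _.
  by rewrite ler_nat ltnW// ltn_expl.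
pose L2 := maxn L0 L1.
pose G (k : nat * nat) := nth set0 (F (k.1 + L2)%N) k.2.
have /card_esym/ppcard_eqP[f] := card_nat2.
apply: (@le_trans _ _ (\sum_(0 <= i <oo) diam_pow t (G (f i)))).
  apply: ereal_inf_lbound; exists (G \o f) => //; split.
    move=> x /(_ L2 I)[L /= L2L [A /= AF Ax]].
    exists (f^-1%FUN (L - L2, index A (F L))%N) => //=.
    rewrite invK ?inE// /G /= subnK// nth_index//.
  move=> i /=; rewrite /G; set k := f i.
  have [kF|kF] := ltnP k.2 (size (F (k.1 + L2)%N)).
    apply: le_trans (Fr _ _ (mem_nth _ kF)) _; rewrite lee_fin hL0//.
    by rewrite (leq_trans (leq_maxl _ _) (leq_addl _ _)).
  by rewrite nth_default//; exact: diam_set0_le.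
rewrite nneseries_esumT; last by move=> i; exact: diam_pow_ge0.
rewrite -(@reindex_esum _ _ _ setT setT f (fun k => diam_pow t (G k)));
  last first.
  by split.
have -> : [set: nat * nat] = [set: nat] `*`` (fun _ => [set: nat]).
  by apply/seteqP; split.
rewrite -(@esum_esum _ _ _ setT (fun=> setT) (fun i j =>
  diam_pow t (G (i, j)))); last first.
  by move=> i j _ _; exact: diam_pow_ge0.
rewrite -nneseries_esumT; last by move=> i; apply: esum_ge0 => j _;
  exact: diam_pow_ge0.
apply: le_trans (_ : \sum_(0 <= i <oo) (a / (2 ^ L2)%:R / (2 ^ i.+1)%:R)%:E <=
  _).
  apply: lee_nneseries => [|i _].
    by move=> *; apply: esum_ge0 => j _; exact: diam_pow_ge0.
  rewrite -nneseries_esumT; last by move=> j; exact: diam_pow_ge0.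
  apply: le_trans (sum_diam_pow_le t0 (r0 (i + L2)%N) (Fr (i + L2)%N)) _.
  rewrite lee_fin; apply: le_trans (size_F _) _.
  by rewrite -addSn addnC expnD natrM invfM mulrA.
apply: le_trans (epsilon_trick0 _ _) _; first by rewrite divr_ge0.
rewrite lee_fin; apply: le_trans hL1; rewrite ler_wpM2l//.
by rewrite lef_pV2 ?posrE ?ltr0n ?expn_gt0// ler_nat leq_pexp2l// leq_maxr.
Qed.

Lemma hausdorff_dim_le t A : (0 <= t)%R -> hausdorff_measure t A = 0 ->
  hausdorff_dim A <= t%:E.
Proof. by move=> t0 h; apply: ereal_inf_lbound; exists t. Qed.

Lemma hausdorff_dim_measure_le (mu : {outer_measure set E -> \bar R}) A :
  borel_sets A -> 0 < mu A -> hausdorff_dim_measure mu <= hausdorff_dim A.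
Proof. by move=> bA A0; apply: ereal_inf_lbound; exists A. Qed.

End Hausdorff.

(** * The tree of heavy cubes *)

Section Tree.
Variables (R : realType) (n : nat).
Local Notation E := 'rV[R]_n.
Variable mu : {outer_measure set E -> \bar R}.
Hypothesis mu_meas : is_measure mu.
Variables (A : set E) (N : nat) (p0 : E) (l0 : R).
Hypotheses (N0 : (0 < N)%N) (l00 : 0 < l0).
Let T : finType := {ffun 'I_n -> 'I_N}.

(** Nodes of the N-adic tree below box p0 l0, named by words of indices of
    subcubes as in [words]. *)
Definition side (j : nat) : R := l0 / (N ^ j)%:R.

Fixpoint corner (w : seq T) : E :=
  if w is a :: w' then corner w' + side (size w) *: offset R a else p0.

Definition node (w : seq T) : set E := box (corner w) (side (size w)).

Definition node_halo (w : seq T) : set E := halo (corner w) (side (size w)).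

Definition node_mass (w : seq T) : R := mass mu (A `&` node w).

Lemma side_gt0 j : 0 < side j.
Proof. by rewrite divr_gt0// ltr0n expn_gt0 N0. Qed.

Lemma sideS j : N%:R * side j.+1 = side j.
Proof.
rewrite /side expnS natrM invfM mulrCA !mulrA mulfK//.
by rewrite pnatr_eq0 -lt0n.
Qed.

Lemma side_le j : side j <= l0.
Proof. by rewrite ler_pdivrMr ?ltr0n ?expn_gt0 ?N0// ler_peMr ?ler1n ?expn_gt0
  ?N0// ltW. Qed.

Lemma node_child a w : node (a :: w) `<=` node w.
Proof. by rewrite /node /= -(sideS (size w)); apply: child_sub;
  exact: side_gt0. Qed.

Lemma node_split w x : node w x -> exists a, node (a :: w) x.
Proof. by rewrite /node -(sideS (size w)); apply: child_cover;
  exact: side_gt0. Qed.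

Lemma node_child_inj a b w x : node (a :: w) x -> node (b :: w) x -> a = b.
Proof. by apply: child_inj; exact: side_gt0. Qed.

Lemma node_inj w w' x : size w = size w' -> node w x -> node w' x -> w = w'.
Proof.
elim: w w' => [|a w IH] [|a' w'] // [sw] xa xa'.
have e : w = w' by apply: IH sw (node_child xa) (node_child xa').
by rewrite e in xa *; rewrite (node_child_inj xa xa').
Qed.

Lemma node_halo_root w : node_halo w `<=` node_halo [::].
Proof.
elim: w => // a w; apply: subset_trans.
by rewrite /node_halo /= -(sideS (size w)); apply: halo_child; exact: side_gt0.
Qed.

Lemma borel_node w : borel_sets (node w).
Proof. exact: borel_box. Qed.

Lemma node_mass_ge0 w : 0 <= node_mass w.
Proof. exact: mass_ge0. Qed.

Lemma sum_node_mass_le w : \sum_a node_mass (a :: w) <= node_mass w.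
Proof.
rewrite -big_enum /=; apply: mass_disjoint => //.
- exact: enum_uniq.
- by move=> a _; exact: borel_node.
- by move=> a _; exact: node_child.
- by move=> a b _ _ [x [xa xb]]; exact: node_child_inj xa xb.
Qed.

Lemma root_mass_le J : node_mass [::] <= \sum_(w <- words T J) node_mass w.
Proof.
elim: J => [|J IH]; first by rewrite big_seq1.
rewrite big_words; apply: le_trans IH _; apply: ler_sum => w _.
rewrite -big_enum; apply: mass_bigcup_le => // x [Ax /node_split[a xa]].
by exists a; rewrite ?mem_enum.
Qed.

Variable eps : R.
Hypothesis eps0 : 0 <= eps.

Definition heavy (w : seq T) (a : T) : bool :=
  eps * mass mu (node_halo w) < node_mass (a :: w).

(** A subcube of Q reached by a bad step carries at most eps times the mass of
    the halo of Q; there are at most N^n of them, and the halos of one level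
    overlap boundedly. *)
Lemma bad_mass_le j :
  \sum_(w <- words T j) \sum_(a | ~~ heavy w a) node_mass (a :: w) <=
  (N ^ n)%:R * (eps * (((2 * n).+1 ^ n)%:R * mass mu (node_halo [::]))).
Proof.
apply: (@le_trans _ _ (\sum_(w <- words T j)
    (N ^ n)%:R * (eps * mass mu (node_halo w)))).
  apply: ler_sum => w _.
  have -> : (N ^ n)%N = #|T| by rewrite card_ffun !card_ord.
  rewrite mulr_natl -sumr_const big_mkcond; apply: ler_sum => a _.
  case: ifPn => [|_]; first by rewrite /heavy -leNgt.
  by rewrite mulr_ge0// mass_ge0.
rewrite -mulr_sumr -mulr_sumr ler_wpM2l// ler_wpM2l//.
have size_w w : w \in words T j -> size w = j by exact: size_words.
rewrite (eq_big_seq (fun w => mass mu (halo (corner w) (side j)))); last first.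
  by move=> w /size_w; rewrite /node_halo => ->.
apply: halo_overlap => //.
- exact: side_gt0.
- exact: words_uniq.
- move=> w w' x /size_w sw /size_w sw' xw xw'.
  by apply: (@node_inj _ _ x); rewrite /node ?sw ?sw'.
- by move=> w /size_w sw; have := @node_halo_root w; rewrite /node_halo sw.
Qed.

Definition leaves (J d : nat) : seq (seq T) :=
  [seq w <- words T J | (nbad heavy w <= d)%N].

Definition leaf_union (J d : nat) : set E :=
  \bigcup_(Q in [set` [seq node w | w <- leaves J d]]) Q.

Lemma borel_leaf_union J d : borel_sets (leaf_union J d).
Proof.
rewrite borelE; apply: fin_bigcup_measurable; first exact: finite_seq.
by move=> _ /= /mapP[w _ ->]; exact: borel_node.
Qed.

Lemma leaf_union_mass J d :
  node_mass [::] - J%:R * ((N ^ n)%:R * (eps * (((2 * n).+1 ^ n)%:R *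
     mass mu (node_halo [::])))) / d.+1%:R <=
  mass mu (leaf_union J d).
Proof.
have := mass_few_bad node_mass_ge0 sum_node_mass_le d (fun j _ =>
  bad_mass_le j) (J := J).
move=> h; apply: (le_trans _ (le_trans h _)).
  by rewrite lerD2r; exact: root_mass_le.
rewrite -big_filter -[leaf_union J d]setTI;
  apply: (@le_trans _ _ (mass mu (A `&` leaf_union J d))); last first.
  by apply: le_mass => // x [].
apply: mass_disjoint => //.
- by rewrite filter_uniq// words_uniq.
- by move=> w _; exact: borel_node.
- by move=> w wl x xw; exists (node w) => //=; exact: map_f.
- move=> w w'; rewrite !mem_filter => /andP[_ /size_words sw] /andP[_
  /size_words sw'].
  by move=> [x [xw xw']]; apply: node_inj xw xw'; rewrite sw sw'.
Qed.

Section Cones.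
Variables (m K : nat) (alpha r0 : R).
Hypotheses (alpha0 : 0 < alpha) (alpha1 : alpha <= 1) (mn : (m < n)%N).
Hypothesis alphaK : 2 * n%:R * (n%:R + 1) < alpha * K%:R.
Hypothesis l0r0 : n%:R * l0 < r0.
Hypothesis poorA : forall x r, A x -> 0 < r -> r < r0 ->
  exists (theta : E) (V : {vspace E}), [/\ enorm theta = 1, (\dim V = n - m)%N &
    mass mu (bounded_cone x r V alpha `\` half_cone x theta alpha) <=
      eps * mass mu (eball x r)].

(** A heavy subcube meets A.  By [cone_pigeonhole], if there were too many of
    them, one would lie inside X minus H at a point of A, with r = n * side:
    there the mass is at most eps times that of a ball contained in the halo. *)
Lemma few_heavy w : (#|[pred a | heavy w a]| <= cone_bound n m K N)%N.
Proof.
rewrite leqNgt; apply/negP => many.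
pose S : {set T} := [set a | heavy w a]%SET.
have card_S : (cone_bound n m K N < #|S|)%N by rewrite cardsE.
pose r := n%:R * side (size w).
have n0 : 0 < n%:R :> R by rewrite ltr0n (leq_ltn_trans _ mn).
have r_gt0 : 0 < r by rewrite mulr_gt0// side_gt0.
have r_lt : r < r0 by apply: le_lt_trans l0r0; rewrite ler_wpM2l// side_le.
have pick a : exists xtV : E * E * {vspace E}, a \in S ->
    [/\ (A `&` node (a :: w)) xtV.1.1, enorm xtV.1.2 = 1,
      (\dim xtV.2 = n - m)%N &
      mass mu (bounded_cone xtV.1.1 r xtV.2 alpha `\`
        half_cone xtV.1.1 xtV.1.2 alpha) <=
      eps * mass mu (eball xtV.1.1 r)].
  have [aS|aS] := boolP (a \in S); last by exists (0, 0, 0%VS).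
  have : A `&` node (a :: w) !=set0.
    apply/set0P/eqP => e; move: aS; rewrite inE /heavy /node_mass e mass0 ltNge.
    by rewrite mulr_ge0// mass_ge0.
  move=> [x [Ax xa]]; have [theta [V [t1 dV h]]] := poorA Ax r_gt0 r_lt.
  by exists (x, theta, V).
have /choice[F HF] := pick.
have xS a : a \in S -> node (a :: w) (F a).1.1 by move=> /HF[[]].
have thetaS a : a \in S -> enorm (F a).1.2 = 1 by move=> /HF[].
have VS a : a \in S -> (\dim (F a).2 = n - m)%N by move=> /HF[].
have [a [b [aS bS sub]]] := cone_pigeonhole alpha0 alpha1 mn alphaK
  (side_gt0 _) xS thetaS VS card_S.
have [[Aa xa] _ _ h] := HF a aS.
have := bS; rewrite inE /heavy ltNge => /negP; apply.
apply: (@le_trans _ _ (eps * mass mu (eball (F a).1.1 r))); last first.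
  rewrite ler_wpM2l// le_mass// => y yx; apply: (in_halo (node_child xa)) => i.
  exact: le_trans (coord_le_enorm _ i) yx.
apply: le_trans h; apply: le_mass => // y [_ yb].
by have := sub y yb; rewrite sideS.
Qed.

Lemma size_leaves J d :
  (size (leaves J d) <= (2 * cone_bound n m K N) ^ J * (N ^ n) ^ d)%N.
Proof.
have -> : (N ^ n)%N = #|T| by rewrite card_ffun !card_ord.
rewrite size_filter; apply: count_few_bad.
- by rewrite /cone_bound !muln_gt0 !expn_gt0.
- by rewrite card_ffun !card_ord expn_gt0 N0.
- exact: few_heavy.
Qed.

Lemma hausdorff_leaves_null (b : nat) (t : R) : 0 <= t ->
  2 * ((2 * cone_bound n m K N) ^ b * N ^ n)%:R <= (N ^ b)%:R `^ t ->
  (1 < N)%N -> (0 < b)%N ->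
  hausdorff_measure t (lim_sup_set (fun L => leaf_union (b * L) L)) = 0.
Proof.
move=> t0 bt N1 b0.
apply: (@hausdorff_limsup_null R n t (2 * (n%:R * l0) `^ t)
  (fun L => [seq node w | w <- leaves (b * L) L])
  (fun L => n%:R * side (b * L))) => //.
- by move=> L; rewrite mulr_ge0// ltW// side_gt0.
- move=> L _ /mapP[w + ->]; rewrite mem_filter => /andP[_ /size_words sw].
  by rewrite /node -sw; exact: diam_box_le.
- move=> delta d0; exists (Num.truncn (n%:R * l0 / delta)).+1 => L hL.
  rewrite /side mulrA ler_pdivrMr ?ltr0n ?expn_gt0 ?N0// -ler_pdivrMl//.
  rewrite mulrC; apply: le_trans (ltW (truncnS_gt _)) _.
  rewrite ler_nat; apply: leq_trans hL _; apply: (@leq_trans (b * L)).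
    by rewrite leq_pmull.
  by rewrite ltnW// ltn_expl.
move=> L; rewrite size_map.
have Nb0 : 0 < (N ^ b)%:R `^ t by rewrite powR_gt0// ltr0n expn_gt0 N0.
apply: (@le_trans _ _ (((2 * cone_bound n m K N) ^ b * N ^ n)%:R ^+ L *
    (n%:R * side (b * L)) `^ t)).
  rewrite ler_wpM2r ?powR_ge0// -natrX ler_nat;
    apply: leq_trans (size_leaves _ _) _.
  by rewrite expnM -expnMn.
rewrite /side mulrA powRM ?invr_ge0//; last by rewrite mulr_ge0// ltW.
have -> : (N ^ (b * L))%:R^-1 `^ t = ((N ^ b)%:R `^ t) ^- L.
  rewrite -powR_inv1// -powRrM mulN1r powRN expnM natrX -powR_mulrn//.
  by rewrite -powRrM mulrC powRrM powR_mulrn// powR_ge0.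
have -> : (2 ^ L.+1)%:R = 2 * 2 ^+ L :> R by rewrite expnS natrM natrX.
rewrite invfM mulrACA divff// mul1r mulrC -mulrA ler_wpM2l ?powR_ge0//.
rewrite -!exprVn -exprMn lerXn2r ?nnegrE ?mulr_ge0 ?invr_ge0 ?powR_ge0//.
by rewrite mulrC ler_pdivrMr// -ler_pdivrMl ?invr_gt0// invrK.
Qed.

End Cones.
End Tree.

(** * Conclusion *)

Lemma cone_bound_le (n m K N : nat) : (0 < N)%N ->
  (cone_bound n m K N <= cone_bound n m K 1 * N ^ m)%N.
Proof.
move=> N0; rewrite /cone_bound muln1.
rewrite [leqRHS]mulnAC leq_mul2r -[leqRHS]mulnA leq_mul2l -expnMn.
have h : ((2 * (n * N)).+1 <= (2 * n).+1 * N)%N by nia.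
by case: m => [|k]; rewrite ?expn0 ?leqnn ?orbT// leq_exp2r// h !orbT.
Qed.

(** With C1 the value of [cone_bound] at N = 1, the left side is at most
    2 (2 C1)^b * N^(m b + n), so that b >= (n + 1) / (t - m) and
    N = 2 (2 C1)^b suffice. *)
Lemma tree_parameters (R : realType) (n m K : nat) (t : R) : m%:R < t ->
  exists b N : nat, [/\ (0 < b)%N, (1 < N)%N &
    2 * ((2 * cone_bound n m K N) ^ b * N ^ n)%:R <= (N ^ b)%:R `^ t].
Proof.
move=> mt; have tm0 : 0 < t - m%:R by rewrite subr_gt0.
pose b := (Num.truncn (n.+1%:R / (t - m%:R))).+1.
have bt : m%:R * b%:R + n.+1%:R <= b%:R * t.
  rewrite -lerBrDl (mulrC m%:R) -mulrBr -ler_pdivrMr//.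
  exact: ltW (truncnS_gt _).
pose C := (2 * (2 * cone_bound n m K 1) ^ b)%N.
have C1 : (1 < C)%N.
  have : (0 < (2 * cone_bound n m K 1) ^ b)%N.
    by rewrite expn_gt0 /cone_bound !muln_gt0 !expn_gt0.
  by rewrite /C; lia.
exists b, C; split=> //.
have C1R : 1 <= C%:R :> R by rewrite ler1n ltnW.
apply: (@le_trans _ _ ((C ^ (m * b + n.+1))%:R)).
  rewrite -natrM ler_nat.
  apply: (@leq_trans (2 * ((2 * cone_bound n m K 1 * C ^ m) ^ b * C ^ n))).
    rewrite leq_mul2l leq_mul2r; apply/orP; right; apply/orP; right.
    rewrite leq_exp2r// -mulnA leq_mul2l; apply: cone_bound_le.
    exact: ltnW.
  rewrite addnS expnS expnD {3}/C expnMn -expnM.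
  by apply: eq_leq; rewrite !mulnA; congr (_ * _)%N; rewrite -!mulnA.
rewrite natrX -powR_mulrn// natrX -powR_mulrn// -powRrM; apply: ler_powR => //.
by rewrite natrD natrM.
Qed.

Section Main.
Variables (R : realType) (n m : nat) (alpha : R).
Local Notation E := 'rV[R]_n.
Variable mu : {outer_measure set E -> \bar R}.
Hypothesis mu_meas : is_measure mu.

Definition cone_poor (eps r0 : R) : set E :=
  [set x | forall r, 0 < r -> r < r0 ->
    exists (theta : E) (V : {vspace E}),
      [/\ enorm theta = 1, (\dim V = n - m)%N &
    mass mu (bounded_cone x r V alpha `\` half_cone x theta alpha) <=
      eps * mass mu (eball x r)]].

(** When the ball is null, the ratio is 0 / 0; both sides of the inequality then
    vanish. *)
Lemma cone_poor_of_limsup (eps : R) x : 0 < eps ->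
  ~ ((eps / 2)%:E <
     limf_esup (fun r : R => cone_ratio_inf m alpha mu x r) 0^'+)%E ->
  exists k : nat, cone_poor eps k.+1%:R^-1 x.
Proof.
move=> eps0 /negP; rewrite -leNgt => lim_le.
have : (limf_esup (fun r : R => cone_ratio_inf m alpha mu x r) 0^'+ < eps%:E)%E.
  by apply: le_lt_trans lim_le _; rewrite lte_fin ltr_pdivrMr// ltr_pMr// ltr1n.
rewrite limf_esupE => /ereal_inf_lt[_ [F F0 <-] supF].
have [e /= e0 eF] := F0.
exists (Num.truncn e^-1) => r r0 rk.
have Fr : F r.
  apply: eF => //=; rewrite sub0r normrN gtr0_norm//.
  apply: lt_trans rk _; rewrite invf_plt ?posrE//; exact: truncnS_gt.
have : (cone_ratio_inf m alpha mu x r < eps%:E)%E.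
  by apply: le_lt_trans supF; apply: ereal_sup_ubound; exists r.
move=> /ereal_inf_lt[_ [theta t1 [V dV <-]] h].
exists theta, V; split=> //.
move: h; rewrite !(massE mu_meas); set B := mass mu (eball x r).
have [B0 _|B0] := eqVneq B 0.
  rewrite B0 mulr0 -B0; apply: le_mass => //.
  by move=> y [[yB _] _].
rewrite inver (negbTE B0) -EFinM lte_fin ltr_pdivrMr; first exact: ltW.
by rewrite lt_def B0 mass_ge0.
Qed.

End Main.

Theorem theorem4p1 (R : realType) (n m : nat) (s alpha : R)
    (hm : (m < n)%N) (hs : m%:R < s) (halpha0 : 0 < alpha)
    (halpha1 : alpha <= 1) :
  exists c : R, 0 < c /\
    forall mu : {outer_measure set 'rV[R]_n -> \bar R},
      is_measure mu ->
      (s%:E <= hausdorff_dim_measure mu)%E ->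
      outer_ae mu (fun x : 'rV[R]_n =>
        (c%:E < limf_esup (fun r : R => cone_ratio_inf m alpha mu x r)
                          0^'+)%E).
Proof.
pose t := (m%:R + s) / 2.
have mt : m%:R < t by rewrite ltr_pdivlMr//; lra.
have ts : t < s by rewrite ltr_pdivrMr//; lra.
have t0 : 0 <= t by apply: le_trans (ltW mt).
pose K := (Num.truncn (2 * n%:R * (n%:R + 1) / alpha)).+1.
have alphaK : 2 * n%:R * (n%:R + 1) < alpha * K%:R.
  by rewrite [ltRHS]mulrC -ltr_pdivrMr//; exact: truncnS_gt.
have [b [N [b0 N1 bNt]]] := tree_parameters n K mt.
have N0 : (0 < N)%N by exact: ltnW.
pose P : R := ((2 * n).+1 ^ n)%:R; pose D : R := (N ^ n)%:R.
have P0 : 0 < P by rewrite ltr0n expn_gt0.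
have D0 : 0 < D by rewrite ltr0n expn_gt0 N0.
have bR0 : 0 < b%:R :> R by rewrite ltr0n.
(* [dense_box] loses a factor 8 P and [bad_mass_le] a factor D P: with this eps
   the bad steps of each level carry at most 1 / (2 b) of the mass of the root,
   hence b * L levels with at most L bad steps allowed cost half of it. *)
pose eps := (16 * b%:R * D * P * P)^-1.
have eps0 : 0 < eps by rewrite invr_gt0 !mulr_gt0.
exists (eps / 2); split; first by rewrite divr_gt0.
move=> mu mu_meas dim_mu; rewrite /outer_ae.
set X := [set x | _].
rewrite massE//; congr (_%:E); apply/eqP; rewrite eq_le mass_ge0 andbT leNgt.
apply/negP => X0.
have [k Ak] := mass_exhaust mu_meas X0 (fun x xX =>
  cone_poor_of_limsup mu_meas eps0 xX).
set A := X `&` _ in Ak.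
have r00 : 0 < k.+1%:R^-1 / (n%:R + 1) :> R by rewrite divr_gt0// ltr_wpDl.
have [p [l [l0 lr dense]]] := dense_box mu_meas Ak r00.
have nl : n%:R * l < k.+1%:R^-1.
  move: lr; rewrite ler_pdivlMr ?ltr_wpDl// => lr.
  by apply: lt_le_trans lr; rewrite mulrDr mulr1 mulrC ltrDl.
have poorA x r : A x -> 0 < r -> r < k.+1%:R^-1 -> _ :=
  fun Ax r0 rr => Ax.2 r r0 rr.
pose U := lim_sup_set (fun L => leaf_union mu A N p l eps (b * L) L).
have U0 : hausdorff_measure t U = 0.
  exact: (hausdorff_leaves_null mu_meas p N0 l0 (ltW eps0) halpha0 halpha1 hm
    alphaK nl poorA t0 bNt N1 b0).
have root : 0 < mass mu (A `&` box p l).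
  rewrite -(@pmulr_rgt0 _ (8 * (2 * n).+1 ^ n)%:R) ?ltr0n ?muln_gt0 ?expn_gt0//.
  by apply: le_lt_trans dense; exact: mass_ge0.
have rootE : node_mass mu A p l ([::] : seq {ffun 'I_n -> 'I_N}) =
    mass mu (A `&` box p l).
  by rewrite /node_mass /node /= /side expn0 divr1.
have haloE : node_halo p l ([::] : seq {ffun 'I_n -> 'I_N}) = halo p l.
  by rewrite /node_halo /= /side expn0 divr1.
have massU : mass mu (A `&` box p l) / 2 <= mass mu U.
  apply: (mass_limsup mu_meas) => L; first exact: borel_leaf_union.
  apply: le_trans (leaf_union_mass mu_meas A p N0 l0 (ltW eps0) (b * L) L).
  rewrite rootE haloE lerBrDr -lerBrDl.
  rewrite [leRHS](_ : _ = mass mu (A `&` box p l) / 2); last by field.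
  rewrite ler_pdivrMr ?ltr0n// -/D -/P.
  set nu := mass mu _ in root dense *; set h := mass mu _ in dense *.
  have hP : P * h <= 8 * P * P * nu.
    by rewrite (mulrC 8) -!mulrA ler_pM2l// mulrCA; move: dense;
      rewrite natrM -/P => /ltW; rewrite !mulrA (mulrC P).
  have : (b * L)%:R * (D * (eps * (P * h))) <=
    (b * L)%:R * (D * (eps * (8 * P * P * nu))).
    by rewrite !ler_wpM2l// ltW.
  move/le_trans; apply.
  have -> : (b * L)%:R * (D * (eps * (8 * P * P * nu))) = L%:R * (nu / 2).
    rewrite /eps natrM; field; rewrite !gt_eqF//.
  by rewrite mulrC ler_wpM2l ?divr_ge0 ?ler_nat// ltW.
have bU : borel_sets U by apply: borel_limsup => L; exact: borel_leaf_union.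
have muU : (0 < mu U)%E.
  by rewrite massE// lte_fin; apply: lt_le_trans massU; rewrite divr_gt0.
have := le_trans dim_mu (le_trans (hausdorff_dim_measure_le bU muU)
  (hausdorff_dim_le t0 U0)).
by rewrite lee_fin leNgt ts.
Qed.
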